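(* Let $g>0$ and $d>0$ be fixed and let $\gamma\le 0$ (the favorable case). Consider any water wave that belongs to the bifurcation curve $\mathcal C$ (for the given $g,d,\gamma$). Then its amplitude $\mathscr A=\eta(0)-\eta(\pi)$ (the elevation difference between crest and trough) satisfies $$\mathscr A<\min\left\{2d,\ \frac{1}{|\gamma|}\sqrt{12\,g\,d}\right\},$$ where for $\gamma=0$ the second entry is understood as $+\infty$. Thus (for fixed $g,d$) the amplitude is uniformly bounded, and it tends to zero as $\gamma\to-\infty$.
   Context: **Steady waves.** Let $g>0$ (gravity), $\gamma\in\mathbb R$ (constant vorticity), $m<0$ (mass flux), $Q>0$ (Bernoulli constant). A $2\pi$-periodic steady wave is a fluid domain $\Omega$ in the $(X,Y)$-plane, $2\pi$-periodic in $X$, bounded below by $\mathcal B=\{Y=0\}$ and above by an unknown curve $\mathcal S$ lying strictly above $\mathcal B$, with a stream function $\Psi$ satisfying $\Delta\Psi=-\gamma$ in $\Omega$, $\Psi=0$ on $\mathcal S$, $\Psi=-m$ on $\mathcal B$, $|\nabla\Psi|^2+2gY=Q$ on $\mathcal S$. **Conformal formulation.** $\Omega$ is the image of the strip $\{-d<y<0\}$ under a conformal map $X+iY=\xi(x,y)+i\eta(x,y)$ (periodic up to the translation by $2\pi$ in $X$, mapping $y=-d$ to $\mathcal B$ and $y=0$ to $\mathcal S$); $d>0$ is the conformal depth. Write $\eta(x)=\eta(x,0)$, $\xi(x)=\xi(x,0)$, and $[\cdot]$ for the average over a period. The periodic Hilbert transform of the strip is $$\mathcal H\Big(\sum_{n\ge1}(a_n\cos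 nx+b_n\sin nx)\Big)=\sum_{n\ge1}\big(a_n\coth(nd)\sin nx-b_n\coth(nd)\cos nx\big)$$ on mean-zero $2\pi$-periodic $L^2$ functions. With $\psi(x,y)=\Psi(\xi(x,y),\eta(x,y))$, $$\psi_y(x,0)=\frac md+\frac{\gamma}{2d}[\eta^2]+\gamma\mathcal H(\eta\eta')-\gamma\eta\,\mathcal H(\eta')-\gamma\eta,$$ and the problem is equivalent to $\psi_y(x,0)^2=(Q-2g\eta)\big((\eta')^2+(1+\mathcal H(\eta'))^2\big)$. This is also equivalent to $$\mathcal H\big((Q-2g\eta-\gamma^2\eta^2)\eta'\big)+(Q-2g\eta-\gamma^2\eta^2)\mathcal H(\eta')+2\gamma^2\eta\mathcal H(\eta\eta')=\eta\Big(-\tfrac{2m\gamma}{d}-\tfrac{\gamma^2}{d}[\eta^2]+2g\Big)+\gamma^2\eta^2+2\gamma m-2gd-2g[\eta\mathcal H(\eta')]$$ together with equality of the averages of the two sides of the preceding equation. **The curve $\mathcal C$.** For fixed $g,d,\gamma$, $\mathcal C$ is the continuous curve $s\mapsto(\Psi(s),m(s),Q(s))$, $0\le s<\infty$, of solutions constructed by global bifurcation by Constantin, Strauss and Varvaruca. It begins at the laminar flow ($\eta\equiv d$), and all its waves satisfy: $m<0$, $Q>0$; $\eta\in C^{2,\alpha}(\mathbb R)$ for some $\alpha\in(0,1)$, $\eta$ is $2\pi$-periodic and even, $[\eta]=d$; $x\mapsto(\xi(x),\eta(x))$ is injective on $\mathbb R$; $\inf_x (Q-2g\eta)^2|\nabla\eta|^2>0$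 on $y=0$, with $Q-2g\eta>0$; the nonlaminar waves have $\eta'<0$ on $(0,\pi)$ and $\eta'>0$ on $(-\pi,0)$ (crest at $x=0$, trough at $x=\pi$). The curve ends with one of: the $C^{2,\alpha}$ norm is unbounded; $|m(s)|+Q(s)\to\infty$; $\min_x\{Q(s)-2g\eta_s(x)\}\to0$; or the profile self-intersects strictly above the trough at some finite $s^*$. In the favorable case $\gamma\le0$, the waves on $\mathcal C$ satisfy $\psi_y(x,0)\le0$ for all $x$. *)

(* Defs.v *)
(* Stdlib's real numbers, with Coquelicot. *)
From Stdlib Require Import Reals.
From Coquelicot Require Import Coquelicot.
Open Scope R_scope.

(** * Periodic functions and the Hilbert transform of the strip *)

Definition mean (f : R -> R) : R := / (2 * PI) * RInt f 0 (2 * PI).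

Definition fourier_cos (f : R -> R) (n : nat) : R :=
  / PI * RInt (fun x => f x * cos (INR n * x)) 0 (2 * PI).

Definition fourier_sin (f : R -> R) (n : nat) : R :=
  / PI * RInt (fun x => f x * sin (INR n * x)) 0 (2 * PI).

Definition coth (x : R) : R := cosh x / sinh x.

(* [Series] is indexed from 0, hence the shift.  The transform is only applied
   to mean-zero continuously differentiable periodic functions, for which the
   series converges absolutely, so that its pointwise sum is the continuous
   representative of the L^2 sum. *)
Definition hilbert (d : R) (f : R -> R) (x : R) : R :=
  Series (fun k =>
    let n := S k in
      fourier_cos f n * coth (INR n * d) * sin (INR n * x)
    - fourier_sin f n * coth (INR n * d) * cos (INR n * x)).

(** * The Hölder space C^{2,alpha}(R) *)

Definition sup_norm (f : R -> R) : Rbar :=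
  Lub_Rbar (fun r => exists x, r = Rabs (f x)).

Definition holder_seminorm (alpha : R) (f : R -> R) : Rbar :=
  Lub_Rbar (fun r => exists x y,
    x <> y /\ r = Rabs (f x - f y) / Rpower (Rabs (x - y)) alpha).

Definition C2alpha_norm (alpha : R) (f : R -> R) : Rbar :=
  Rbar_plus (sup_norm f)
    (Rbar_plus (sup_norm (Derive f))
      (Rbar_plus (sup_norm (Derive_n f 2)) (holder_seminorm alpha (Derive_n f 2)))).

Definition C2alpha (alpha : R) (f : R -> R) : Prop :=
  (forall x, ex_derive_n f 1 x /\ ex_derive_n f 2 x) /\
  Rbar_lt (C2alpha_norm alpha f) p_infty.

(** * Steady waves *)

(* A wave of conformal depth [d] is given by the conformal map
   [x + i y |-> Xi x y + i Eta x y] of the strip [-d < y < 0], the stream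
   function [Psi] in physical variables, the mass flux and the Bernoulli
   constant.  Values of [Xi], [Eta] off the closed strip and of [Psi] off the
   fluid domain are irrelevant. *)
Record wave : Type := mkWave {
  Xi : R -> R -> R;
  Eta : R -> R -> R;
  Psi : R -> R -> R;
  flux : R;
  head : R }.

Definition xi (w : wave) (x : R) : R := Xi w x 0.
Definition eta (w : wave) (x : R) : R := Eta w x 0.

Definition amplitude (w : wave) : R := eta w 0 - eta w PI.

Definition fluid (d : R) (w : wave) (X Y : R) : Prop :=
  exists x y, - d < y < 0 /\ X = Xi w x y /\ Y = Eta w x y.

Definition bottom (X Y : R) : Prop := Y = 0.

Definition surface (w : wave) (X Y : R) : Prop :=
  exists x, X = xi w x /\ Y = eta w x.

Definition lim_within (D : R -> R -> Prop) (f : R -> R -> R) (a b l : R) : Prop :=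
  filterlim (fun p : R * R => f (fst p) (snd p))
    (within (fun p : R * R => D (fst p) (snd p)) (locally (a, b)))
    (locally l).

Definition closed_strip (d x y : R) : Prop := - d <= y <= 0.

(* Global injectivity is not part of this definition: it is lost by the
   limiting profile when the curve of solutions ends with a self-intersection. *)
Record conformal_parametrization (d : R) (w : wave) : Prop := {
  cp_smooth : forall x y, - d < y < 0 ->
    ex_diff_n (Xi w) 1 x y /\ ex_diff_n (Eta w) 1 x y;
  cp_cauchy_riemann : forall x y, - d < y < 0 ->
    Derive (fun t => Xi w t y) x = Derive (fun t => Eta w x t) y /\
    Derive (fun t => Xi w x t) y = - Derive (fun t => Eta w t y) x;
  cp_continuous : forall x y, closed_strip d x y ->
    lim_within (closed_strip d) (Xi w) x y (Xi w x y) /\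
    lim_within (closed_strip d) (Eta w) x y (Eta w x y);
  cp_periodic : forall x y, closed_strip d x y ->
    Xi w (x + 2 * PI) y = Xi w x y + 2 * PI /\
    Eta w (x + 2 * PI) y = Eta w x y;
  cp_bottom : forall x, Eta w x (- d) = 0 }.

(* The free-boundary problem.  Boundary values of [Psi] and of its gradient are
   limits from inside the fluid. *)
Record steady_wave (g gamma d : R) (w : wave) : Prop := {
  sw_param : conformal_parametrization d w;
  sw_param_inj : forall x y x' y',
    - d < y < 0 -> - d < y' < 0 ->
    Xi w x y = Xi w x' y' -> Eta w x y = Eta w x' y' -> x = x' /\ y = y';
  sw_surface_inj : forall x x',
    xi w x = xi w x' -> eta w x = eta w x' -> x = x';
  sw_surface_above : forall x, 0 < eta w x;
  sw_boundary : forall X Y,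
    (~ fluid d w X Y /\
     forall eps : posreal, exists X' Y',
       fluid d w X' Y' /\ Rabs (X' - X) < eps /\ Rabs (Y' - Y) < eps)
    <-> (bottom X Y \/ surface w X Y);
  sw_periodic : forall X Y, fluid d w X Y -> Psi w (X + 2 * PI) Y = Psi w X Y;
  sw_smooth : forall X Y, fluid d w X Y -> ex_diff_n (Psi w) 2 X Y;
  sw_laplace : forall X Y, fluid d w X Y ->
    Derive_n (fun t => Psi w t Y) 2 X + Derive_n (fun t => Psi w X t) 2 Y = - gamma;
  sw_psi_surface : forall X Y, surface w X Y ->
    lim_within (fluid d w) (Psi w) X Y 0;
  sw_psi_bottom : forall X Y, bottom X Y ->
    lim_within (fluid d w) (Psi w) X Y (- flux w);
  sw_bernoulli : forall X Y, surface w X Y ->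
    lim_within (fluid d w)
      (fun U V => Derive (fun t => Psi w t V) U ^ 2 + Derive (fun t => Psi w U t) V ^ 2
                  + 2 * g * V) X Y (head w) }.

(** * The conformal formulation *)

(* [eta_y] on the surface is [1 + H(eta')]. *)
Definition grad_eta_sq (d : R) (w : wave) (x : R) : R :=
  Derive (eta w) x ^ 2 + (1 + hilbert d (Derive (eta w)) x) ^ 2.

Definition psi_y (gamma d : R) (w : wave) (x : R) : R :=
  flux w / d + gamma / (2 * d) * mean (fun t => eta w t ^ 2)
  + gamma * hilbert d (fun t => eta w t * Derive (eta w) t) x
  - gamma * eta w x * hilbert d (Derive (eta w)) x
  - gamma * eta w x.

Definition psi_y_is_derivative (gamma d : R) (w : wave) : Prop :=
  forall x,
    filterlim (fun y => Derive (fun t => Psi w (Xi w x t) (Eta w x t)) y)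
      (at_left 0) (locally (psi_y gamma d w x)).

Definition conformal_bernoulli (g gamma d : R) (w : wave) : Prop :=
  forall x,
    psi_y gamma d w x ^ 2 = (head w - 2 * g * eta w x) * grad_eta_sq d w x.

Definition coefficient (g gamma : R) (w : wave) (x : R) : R :=
  head w - 2 * g * eta w x - gamma ^ 2 * eta w x ^ 2.

Definition surface_equation (g gamma d : R) (w : wave) : Prop :=
  forall x,
    hilbert d (fun t => coefficient g gamma w t * Derive (eta w) t) x
    + coefficient g gamma w x * hilbert d (Derive (eta w)) x
    + 2 * gamma ^ 2 * eta w x * hilbert d (fun t => eta w t * Derive (eta w) t) x
    = eta w x * (- (2 * flux w * gamma / d)
                 - gamma ^ 2 / d * mean (fun t => eta w t ^ 2) + 2 * g)
      + gamma ^ 2 * eta w x ^ 2 + 2 * gamma * flux w - 2 * g * d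
      - 2 * g * mean (fun t => eta w t * hilbert d (Derive (eta w)) t).

Definition mean_bernoulli (g gamma d : R) (w : wave) : Prop :=
  mean (fun x => psi_y gamma d w x ^ 2) =
  mean (fun x => (head w - 2 * g * eta w x) * grad_eta_sq d w x).

(* Solutions of the conformal problem, in its equivalent forms. *)
Record conformal_solution (g gamma d : R) (w : wave) : Prop := {
  cs_param : conformal_parametrization d w;
  cs_mean : mean (eta w) = d;
  cs_even : forall x, eta w (- x) = eta w x;
  cs_bernoulli : conformal_bernoulli g gamma d w;
  cs_surface : surface_equation g gamma d w;
  cs_mean_bernoulli : mean_bernoulli g gamma d w }.

(** * The bifurcation curve *)

Definition laminar (d : R) (w : wave) : Prop := forall x, eta w x = d.

Record curve_wave (g gamma d : R) (w : wave) : Prop := {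
  cw_steady : steady_wave g gamma d w;
  cw_psi_y : psi_y_is_derivative gamma d w;
  cw_flux : flux w < 0;
  cw_head : 0 < head w;
  cw_no_stagnation : forall x, 0 < head w - 2 * g * eta w x;
  cw_nondegenerate : exists c, 0 < c /\ forall x,
    c <= (head w - 2 * g * eta w x) ^ 2 * grad_eta_sq d w x;
  cw_monotone : ~ laminar d w ->
    (forall x, 0 < x < PI -> Derive (eta w) x < 0) /\
    (forall x, - PI < x < 0 -> 0 < Derive (eta w) x);
  cw_favorable : gamma <= 0 -> forall x, psi_y gamma d w x <= 0 }.

Definition self_intersects_above_trough (w : wave) : Prop :=
  exists x x', x <> x' /\ xi w x = xi w x' /\ eta w x = eta w x' /\
               eta w PI < eta w x.

(* The solutions form a continuous curve over the half-line; they are waves up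
   to the parameter [send], which is finite exactly when the profile
   self-intersects there. *)
Record bifurcation_curve (g gamma d : R) (C : R -> wave) (send : Rbar) : Prop := {
  bc_end_pos : Rbar_lt 0 send;
  bc_start : laminar d (C 0);
  bc_solution : forall s, 0 <= s -> conformal_solution g gamma d (C s);
  bc_wave : forall s, 0 <= s -> Rbar_lt s send -> curve_wave g gamma d (C s);
  bc_curve : exists alpha, 0 < alpha < 1 /\
    (forall s, 0 <= s -> C2alpha alpha (eta (C s))) /\
    (forall s, 0 <= s -> forall eps : posreal, exists delta : posreal,
       forall s', 0 <= s' -> Rabs (s' - s) < delta ->
         Rbar_lt (C2alpha_norm alpha (fun x => eta (C s') x - eta (C s) x)) eps /\
         Rabs (flux (C s') - flux (C s)) < eps /\
         Rabs (head (C s') - head (C s)) < eps) /\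
    ((send = p_infty /\
       ((forall M : R, exists s, 0 <= s /\
           Rbar_lt M (C2alpha_norm alpha (eta (C s)))) \/
        is_lim (fun s => Rabs (flux (C s)) + head (C s)) p_infty p_infty \/
        is_lim (fun s => real (Glb_Rbar (fun r =>
                  exists x, r = head (C s) - 2 * g * eta (C s) x))) p_infty 0)) \/
     (exists sstar : R, send = Finite sstar /\
        self_intersects_above_trough (C sstar))) }.

Definition on_bifurcation_curve (g gamma d : R) (w : wave) : Prop :=
  exists (C : R -> wave) (send : Rbar) (s : R),
    bifurcation_curve g gamma d C send /\
    0 <= s /\ Rbar_lt s send /\ w = C s.

(* [sqrt (12 g d) / |gamma|], with the convention for irrotational flow. *)
Definition vorticity_bound (g d gamma : R) : Rbar :=
  if Req_EM_T gamma 0 then p_infty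
  else Finite (/ Rabs gamma * sqrt (12 * g * d)).

(* Main.v *)
Require Import Defs.
From Stdlib Require Import Reals ZArith Lra Lia ClassicalEpsilon.
From Coquelicot Require Import Coquelicot.
Open Scope R_scope.

(* On functions of the form [f'], the Hilbert transform of the strip is the
   Dirichlet-to-Neumann operator less the mean of [f] over [d], so by the minimum
   principle [hilbert d f' x <= - mean f / d] whenever [f >= 0] vanishes at [x].
   All nonlocal terms of the surface equation and of [psi_y] at a point [x] come
   from cubic polynomials in [eta].  Subtract the surface equation at the trough
   (height [b]) from the one at the crest, and use [psi_y <= 0] at both points to
   eliminate the flux.  With [A] the amplitude, what remains is nonlocal terms of
   favourable sign and [gamma^2 A^2 / 6 + g A < 2 g b].  Since [b <= d], this
   yields [A < 2 d] and [gamma^2 A^2 < 12 g d]. *)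

(** The obstacle is that [hilbert] is known only through Fourier coefficients, so a sign of [f] says
    nothing about it until the series is shown to represent [f]; Bessel's inequality and Fejér's
    theorem serve this purpose. Two continuous derivatives make the coefficients summable even with
    weight n. The tail of this one weighted sum bounds both the distance from [f] to its partial
    sums and the error in the normal derivative at the surface, so the minimum principle can be
    applied to finite sums of modes, which are harmonic in the whole plane.

    The cubics in the last part are not guessed. Equal weights on the two sign conditions are chosen
    so that the cubic found at the crest and the one found at the trough add up to an affine
    function of [eta]: the second and third moments of the profile cancel, and its mean [d] is all
    that must be known. The 6 is 1/(1/2 - 1/3), from the terms A z^2/2 - z^3/3 of both cubics, and
    12 is twice that. *)

Fixpoint psum (u : nat -> R) (n : nat) : R :=
  match n with O => 0 | S k => psum u k + u k end.

Lemma psum_S u n : psum u (S n) = psum u n + u n.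
Proof. reflexivity. Qed.

Lemma psum_ext u v n : (forall k, u k = v k) -> psum u n = psum v n.
Proof. intros H; induction n; simpl; rewrite ?IHn, ?H; reflexivity. Qed.

Lemma psum_le u v n : (forall k, u k <= v k) -> psum u n <= psum v n.
Proof.
intros H; induction n as [|n IH]; simpl; [lra|]; specialize (H n); lra.
Qed.

Lemma psum_plus u v n : psum (fun k => u k + v k) n = psum u n + psum v n.
Proof. induction n as [|n IH]; simpl; rewrite ?IH; ring. Qed.

Lemma psum_scal c u n : psum (fun k => c * u k) n = c * psum u n.
Proof. induction n as [|n IH]; simpl; rewrite ?IH; ring. Qed.

Lemma psum_diff_abs u v n m :
  (forall k, Rabs (u k) <= v k) -> (n <= m)%nat ->
  Rabs (psum u m - psum u n) <= psum v m - psum v n.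
Proof.
intros H; induction 1 as [|m Hm IH].
- rewrite !Rminus_diag, Rabs_R0; lra.
- simpl.
  replace (psum u m + u m - psum u n) with ((psum u m - psum u n) + u m) by ring.
  apply Rle_trans with (1 := Rabs_triang _ _).
  specialize (H m); lra.
Qed.

Lemma psum_mono u n m :
  (forall k, 0 <= u k) -> (n <= m)%nat -> psum u n <= psum u m.
Proof.
intros H; induction 1 as [|m Hm IH]; simpl; [lra|]; specialize (H m); lra.
Qed.

Lemma sum_n_psum (u : nat -> R) n : sum_n u n = psum u (S n).
Proof.
induction n as [|n IH].
- rewrite sum_O; simpl; ring.
- rewrite sum_Sn, IH; reflexivity.
Qed.

Lemma is_series_psum (u : nat -> R) (l : R) :
  is_series u l <-> is_lim_seq (psum u) l.
Proof.
unfold is_series.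
rewrite (is_lim_seq_incr_1 (psum u)).
split; intros H; refine (filterlim_ext _ _ _ H); intros n;
  now rewrite sum_n_psum.
Qed.

Lemma ex_series_dominated (u v : nat -> R) (M : R) :
  (forall k, Rabs (u k) <= v k) -> (forall n, psum v n <= M) -> ex_series u.
Proof.
intros Huv HM.
apply (ex_series_le (K := R_AbsRing) (V := R_CompleteNormedModule) u v).
- exact Huv.
- destruct (ex_finite_lim_seq_incr (psum v) M) as [l Hl].
  + intros n; simpl; generalize (Huv n) (Rabs_pos (u n)); lra.
  + exact HM.
  + exists l; now apply is_series_psum.
Qed.

(** * Integrals over a period *)

Definition cont (f : R -> R) : Prop := forall x, continuous f x.

Lemma cont_const c : cont (fun _ => c).
Proof. intros x; apply continuous_const. Qed.

Lemma cont_plus f g : cont f -> cont g -> cont (fun t => f t + g t).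
Proof. intros Hf Hg x; apply (continuous_plus f g); auto. Qed.

Lemma cont_opp f : cont f -> cont (fun t => - f t).
Proof. intros Hf x; apply (continuous_opp f); auto. Qed.

Lemma cont_minus f g : cont f -> cont g -> cont (fun t => f t - g t).
Proof. intros Hf Hg; apply cont_plus; auto; now apply cont_opp. Qed.

Lemma cont_mult f g : cont f -> cont g -> cont (fun t => f t * g t).
Proof. intros Hf Hg x; apply (continuous_mult f g); auto. Qed.

Lemma cont_abs f : cont f -> cont (fun t => Rabs (f t)).
Proof.
intros Hf x; apply (continuous_comp f Rabs); auto; apply continuous_Rabs.
Qed.

Lemma cont_pow f n : cont f -> cont (fun t => f t ^ n).
Proof.
intros Hf; induction n as [|n IH]; simpl; [apply cont_const|].
now apply cont_mult.
Qed.

Lemma cont_cos_lin n x : cont (fun t => cos (n * (t - x))).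
Proof.
intros t; apply (ex_derive_continuous (fun t => cos (n * (t - x)))); auto_derive; auto.
Qed.

Lemma cont_cos n : cont (fun t => cos (n * t)).
Proof.
intros t; apply (ex_derive_continuous (fun t => cos (n * t))); auto_derive; auto.
Qed.

Lemma cont_sin n : cont (fun t => sin (n * t)).
Proof.
intros t; apply (ex_derive_continuous (fun t => sin (n * t))); auto_derive; auto.
Qed.

Lemma cont_psum u n : (forall k, cont (u k)) -> cont (fun t => psum (fun k => u k t) n).
Proof.
intros H; induction n as [|n IH]; simpl; [apply cont_const|].
now apply cont_plus.
Qed.

Create HintDb cont.
#[local] Hint Constants Opaque : cont.
#[local] Hint Resolve cont_const cont_plus cont_opp cont_minus cont_mult cont_abs
  cont_pow cont_cos_lin cont_cos cont_sin cont_psum : cont.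

Definition period_int (f : R -> R) : R := RInt f 0 (2 * PI).

Lemma two_PI_pos : 0 < 2 * PI.
Proof. generalize PI_RGT_0; lra. Qed.

Lemma cont_ex_RInt f a b : cont f -> ex_RInt f a b.
Proof.
intros H; apply (ex_RInt_continuous (V := R_CompleteNormedModule)); intros; apply H.
Qed.

#[local] Hint Resolve cont_ex_RInt : cont.

Lemma period_int_ext f g : (forall t, f t = g t) -> period_int f = period_int g.
Proof. intros H; apply RInt_ext; intros; apply H. Qed.

Lemma period_int_plus f g : cont f -> cont g ->
  period_int (fun t => f t + g t) = period_int f + period_int g.
Proof. intros; apply (RInt_plus f g); auto with cont. Qed.

Lemma period_int_scal c f : cont f ->
  period_int (fun t => c * f t) = c * period_int f.
Proof. intros; apply (RInt_scal f); auto with cont. Qed.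

Lemma period_int_minus f g : cont f -> cont g ->
  period_int (fun t => f t - g t) = period_int f - period_int g.
Proof. intros; apply (RInt_minus f g); auto with cont. Qed.

Lemma period_int_const c : period_int (fun _ => c) = 2 * PI * c.
Proof. unfold period_int; rewrite RInt_const; unfold scal; simpl; unfold mult; simpl; ring. Qed.

Lemma period_int_le f g : cont f -> cont g -> (forall t, f t <= g t) ->
  period_int f <= period_int g.
Proof.
intros; apply RInt_le; auto with cont; generalize two_PI_pos; lra.
Qed.

Lemma period_int_abs f : cont f ->
  Rabs (period_int f) <= period_int (fun t => Rabs (f t)).
Proof.
intros; apply abs_RInt_le; auto with cont; generalize two_PI_pos; lra.
Qed.

Lemma period_int_psum u n : (forall k, cont (u k)) ->
  period_int (fun t => psum (fun k => u k t) n) = psum (fun k => period_int (u k)) n.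
Proof.
intros H; induction n as [|n IH]; simpl.
- rewrite period_int_const; ring.
- rewrite (period_int_plus (fun t => psum (fun k => u k t) n) (u n)), IH; auto with cont.
Qed.

Lemma period_int_derive (F F' : R -> R) :
  (forall x, is_derive F x (F' x)) -> cont F' ->
  period_int F' = F (2 * PI) - F 0.
Proof.
intros HF HF'; apply is_RInt_unique.
apply (is_RInt_derive F F'); intros; [apply HF | apply HF'].
Qed.

(** * Fourier coefficients *)

Lemma sin_nat_2PI n : sin (INR n * (2 * PI)) = 0.
Proof.
replace (INR n * (2 * PI)) with (0 + 2 * INR n * PI) by ring.
rewrite sin_period; apply sin_0.
Qed.

Lemma cos_nat_2PI n : cos (INR n * (2 * PI)) = 1.
Proof.
replace (INR n * (2 * PI)) with (0 + 2 * INR n * PI) by ring.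
rewrite cos_period; apply cos_0.
Qed.

Lemma period_int_cos a : a <> 0 -> sin (a * (2 * PI)) = 0 ->
  period_int (fun t => cos (a * t)) = 0.
Proof.
intros Ha Hs.
rewrite (period_int_derive (fun t : R => / a * sin (a * t)) (fun t : R => cos (a * t))).
- rewrite Hs, !Rmult_0_r, sin_0; ring.
- intros t; auto_derive; auto; field; auto.
- auto with cont.
Qed.

Lemma period_int_cos_cos m n : (0 < m)%nat -> (0 < n)%nat ->
  period_int (fun t => cos (INR m * t) * cos (INR n * t)) =
    if Nat.eq_dec m n then PI else 0.
Proof.
intros Hm Hn.
rewrite (period_int_ext _
  (fun t => / 2 * (cos ((INR m - INR n) * t) + cos ((INR m + INR n) * t)))).
2:{ intros t. replace ((INR m - INR n) * t) with (INR m * t - INR n * t) by ring.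
    replace ((INR m + INR n) * t) with (INR m * t + INR n * t) by ring.
    rewrite cos_minus, cos_plus; field. }
rewrite period_int_scal, period_int_plus; auto with cont.
assert (Hp : 0 < INR m + INR n).
{ apply lt_INR in Hm, Hn; simpl in Hm, Hn; lra. }
rewrite (period_int_cos (INR m + INR n)).
2: lra.
2:{ rewrite <- plus_INR; apply sin_nat_2PI. }
destruct (Nat.eq_dec m n) as [->|Hmn].
- rewrite (period_int_ext _ (fun _ => 1)), period_int_const.
  + field.
  + intros t. replace ((INR n - INR n) * t) with 0 by ring. apply cos_0.
- rewrite period_int_cos; [ring| |].
  + intros H; apply Hmn, INR_eq; lra.
  + replace ((INR m - INR n) * (2 * PI)) with
      (INR m * (2 * PI) - INR n * (2 * PI)) by ring.
    rewrite sin_minus, !sin_nat_2PI; ring.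
Qed.

Lemma period_int_sin_sin m n : (0 < m)%nat -> (0 < n)%nat ->
  period_int (fun t => sin (INR m * t) * sin (INR n * t)) =
    if Nat.eq_dec m n then PI else 0.
Proof.
intros Hm Hn.
rewrite (period_int_ext _
  (fun t => cos ((INR m - INR n) * t) - cos (INR m * t) * cos (INR n * t))).
2:{ intros t. replace ((INR m - INR n) * t) with (INR m * t - INR n * t) by ring.
    rewrite cos_minus; ring. }
rewrite period_int_minus, period_int_cos_cos; auto with cont.
destruct (Nat.eq_dec m n) as [->|Hmn].
- rewrite (period_int_ext _ (fun _ => 1)), period_int_const.
  + field.
  + intros t. replace ((INR n - INR n) * t) with 0 by ring. apply cos_0.
- rewrite period_int_cos; [ring| |].
  + intros H; apply Hmn, INR_eq; lra.
  + replace ((INR m - INR n) * (2 * PI)) with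
      (INR m * (2 * PI) - INR n * (2 * PI)) by ring.
    rewrite sin_minus, !sin_nat_2PI; ring.
Qed.

(** Modes are removed one at a time. The residual [r n] is [g] less modes orthogonal to [e n], hence
    has the same coefficient [c n] as [g], and removing that mode lowers the integral of the square
    by [PI * c n ^ 2]. What remains is nonnegative. *)
Lemma bessel (e : nat -> R -> R) (g : R -> R) (N : nat) :
  (forall k, cont (e k)) -> cont g ->
  (forall m n, period_int (fun t => e m t * e n t) = if Nat.eq_dec m n then PI else 0) ->
  psum (fun k => (/ PI * period_int (fun t => g t * e k t)) ^ 2) N
    <= / PI * period_int (fun t => g t ^ 2).
Proof.
intros He Hg Horth.
set (c := fun k => / PI * period_int (fun t => g t * e k t)).
set (r := fun N t => g t - psum (fun k => c k * e k t) N).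
assert (HPI := PI_RGT_0).
assert (Hr : forall n, cont (r n)).
{ intros n; unfold r; apply cont_minus; auto.
  apply (cont_psum (fun k t => c k * e k t)); auto with cont. }
assert (Hre : forall n, period_int (fun t => r n t * e n t) = PI * c n).
{ intros n.
  rewrite (period_int_ext _
    (fun t => g t * e n t - psum (fun k => c k * (e k t * e n t)) n)).
  2:{ intros t; unfold r; rewrite Rmult_minus_distr_r, (Rmult_comm (psum _ _)), <- psum_scal.
      f_equal; apply psum_ext; intros k; ring. }
  rewrite period_int_minus; auto with cont.
  rewrite (period_int_psum (fun k t => c k * (e k t * e n t))); auto with cont.
  replace (psum _ n) with 0.
  { unfold c; field; lra. }
  assert (H : forall m, (m <= n)%nat ->
    psum (fun k => period_int (fun t => c k * (e k t * e n t))) m = 0).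
  { induction m as [|m IH]; intros Hm; simpl; [reflexivity|].
    rewrite IH by lia.
    rewrite period_int_scal, Horth; auto with cont.
    destruct (Nat.eq_dec m n); [lia|ring]. }
  symmetry; now apply H. }
assert (HI : forall n, period_int (fun t => r n t ^ 2) =
   period_int (fun t => g t ^ 2) - PI * psum (fun k => c k ^ 2) n).
{ induction n as [|n IH].
  - simpl psum; rewrite Rmult_0_r, Rminus_0_r; apply period_int_ext.
    intros t; unfold r; simpl; ring.
  - rewrite (period_int_ext _
      (fun t => r n t ^ 2 - 2 * c n * (r n t * e n t) + c n ^ 2 * (e n t * e n t))).
    2:{ intros t; unfold r; simpl; ring. }
    rewrite period_int_plus, period_int_minus, !period_int_scal; auto with cont.
    rewrite IH, Hre, Horth.
    destruct (Nat.eq_dec n n) as [_|?]; [simpl; ring|congruence]. }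
assert (H0 : 0 <= period_int (fun t => r N t ^ 2)).
{ replace 0 with (period_int (fun _ => 0)) by (rewrite period_int_const; ring).
  apply period_int_le; auto with cont. intros t; apply pow2_ge_0. }
rewrite HI in H0.
apply Rmult_le_reg_l with PI; [lra|].
change (psum _ N) with (psum (fun k => c k ^ 2) N).
rewrite <- Rmult_assoc, Rinv_r; lra.
Qed.

(** * Decay of the Fourier coefficients of twice differentiable periodic functions *)

Definition periodic (f : R -> R) : Prop := forall x, f (x + 2 * PI) = f x.

Record C2_periodic (f : R -> R) : Prop := {
  c2_periodic : periodic f;
  c2_derive : forall x, ex_derive f x;
  c2_derive2 : forall x, ex_derive (Derive f) x;
  c2_cont : cont (Derive (Derive f)) }.

Lemma derivable_cont (f : R -> R) : (forall x, ex_derive f x) -> cont f.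
Proof. intros H x; apply (ex_derive_continuous f), H. Qed.

Lemma periodic_derive f : periodic f -> periodic (Derive f).
Proof.
intros H x; unfold Derive; f_equal; apply Lim_ext; intros h.
replace (x + 2 * PI + h) with (x + h + 2 * PI) by ring.
now rewrite !H.
Qed.

Lemma fourier_cos_derive f n : periodic f -> (forall x, ex_derive f x) -> cont (Derive f) ->
  fourier_cos (Derive f) n = INR n * fourier_sin f n.
Proof.
intros Hp Hd Hc.
assert (Hf := derivable_cont f Hd).
unfold fourier_cos, fourier_sin; fold (period_int (fun x => Derive f x * cos (INR n * x)));
  fold (period_int (fun x => f x * sin (INR n * x))).
enough (period_int (fun x => Derive f x * cos (INR n * x) - INR n * (f x * sin (INR n * x))) = 0)
  as H.
{ rewrite period_int_minus, period_int_scal in H; auto with cont.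
  rewrite (Rmult_comm (INR n)), Rmult_assoc; f_equal; lra. }
rewrite (period_int_derive (fun x => f x * cos (INR n * x))); auto with cont.
- rewrite cos_nat_2PI, Rmult_0_r, cos_0, <- (Hp 0), Rplus_0_l; ring.
- intros x; auto_derive; [apply Hd|]. rewrite Rmult_1_l, Rmult_1_r.
  change (Derive (fun x => f x) x) with (Derive f x). ring.
Qed.

Lemma fourier_sin_derive f n : periodic f -> (forall x, ex_derive f x) -> cont (Derive f) ->
  fourier_sin (Derive f) n = - (INR n * fourier_cos f n).
Proof.
intros Hp Hd Hc.
assert (Hf := derivable_cont f Hd).
unfold fourier_cos, fourier_sin; fold (period_int (fun x => Derive f x * sin (INR n * x)));
  fold (period_int (fun x => f x * cos (INR n * x))).
enough (period_int (fun x => Derive f x * sin (INR n * x) + INR n * (f x * cos (INR n * x))) = 0)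
  as H.
{ rewrite period_int_plus, period_int_scal in H; auto with cont.
  replace (period_int (fun t => Derive f t * sin (INR n * t))) with
    (- (INR n * period_int (fun t => f t * cos (INR n * t)))) by lra. ring. }
rewrite (period_int_derive (fun x => f x * sin (INR n * x))); auto with cont.
- rewrite sin_nat_2PI, !Rmult_0_r, sin_0; ring.
- intros x; auto_derive; [apply Hd|]. rewrite Rmult_1_l, Rmult_1_r.
  change (Derive (fun x => f x) x) with (Derive f x). ring.
Qed.

Lemma fourier_cos_bessel g N : cont g ->
  psum (fun k => fourier_cos g (S k) ^ 2) N <= / PI * period_int (fun t => g t ^ 2).
Proof.
intros Hg; apply (bessel (fun k t => cos (INR (S k) * t))); auto.
- intros k; apply cont_cos.
- intros m n; rewrite period_int_cos_cos by lia.
  destruct (Nat.eq_dec m n), (Nat.eq_dec (S m) (S n)); auto; lia.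
Qed.

Lemma fourier_sin_bessel g N : cont g ->
  psum (fun k => fourier_sin g (S k) ^ 2) N <= / PI * period_int (fun t => g t ^ 2).
Proof.
intros Hg; apply (bessel (fun k t => sin (INR (S k) * t))); auto.
- intros k; apply cont_sin.
- intros m n; rewrite period_int_sin_sin by lia.
  destruct (Nat.eq_dec m n), (Nat.eq_dec (S m) (S n)); auto; lia.
Qed.

Lemma psum_inv_sqr N : psum (fun k => / INR (S k) ^ 2) N <= 2.
Proof.
(* The bound that passes through the induction: 1/(n+1)^2 is at most 1/n - 1/(n+1), which
   telescopes. *)
enough (psum (fun k => / INR (S k) ^ 2) (S N) <= 2 - / INR (S N)) as H.
{ assert (0 < / INR (S N)) by (apply Rinv_0_lt_compat, lt_0_INR; lia).
  assert (0 < / INR (S N) ^ 2) by (apply Rinv_0_lt_compat, pow_lt, lt_0_INR; lia).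
  change (psum (fun k => / INR (S k) ^ 2) N + / INR (S N) ^ 2 <= 2 - / INR (S N)) in H. lra. }
induction N as [|N IH]; [simpl; lra|].
change (psum (fun k => / INR (S k) ^ 2) (S N) + / INR (S (S N)) ^ 2 <= 2 - / INR (S (S N))).
assert (Hn : 0 < INR (S N)) by (apply lt_0_INR; lia).
rewrite (S_INR (S N)); set (n := INR (S N)) in *.
assert (/ (n + 1) ^ 2 <= / n - / (n + 1)); [|lra].
replace (/ n - / (n + 1)) with (/ (n * (n + 1))) by (field; lra).
apply Rinv_le_contravar; nra.
Qed.

Definition coef_size (f : R -> R) (k : nat) : R :=
  Rabs (fourier_cos f (S k)) + Rabs (fourier_sin f (S k)).

Lemma coef_size_pos f k : 0 <= coef_size f k.
Proof. apply Rplus_le_le_0_compat; apply Rabs_pos. Qed.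

(** The weight n is the growth rate of the multiplier of [hilbert] on derivatives. Up to sign, n^2
    times a coefficient of [f] is a coefficient of the second derivative, whose squares are summable
    by Bessel; the missing factor 1/n is square summable too. *)
Lemma coef_size_summable f : C2_periodic f ->
  exists M, forall N, psum (fun k => INR (S k) * coef_size f k) N <= M.
Proof.
intros [Hp Hd Hd2 Hc].
assert (Hf' := derivable_cont _ Hd2).
assert (Hp' := periodic_derive _ Hp).
set (B := / PI * period_int (fun t => Derive (Derive f) t ^ 2)).
exists (B + 2); intros N.
assert (H : forall k, INR (S k) * coef_size f k <=
  / 2 * (fourier_cos (Derive (Derive f)) (S k) ^ 2)
  + / 2 * (fourier_sin (Derive (Derive f)) (S k) ^ 2) + / INR (S k) ^ 2).
{ intros k; unfold coef_size.
  rewrite fourier_cos_derive, fourier_sin_derive, fourier_sin_derive, fourier_cos_derive; auto.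
  assert (Hn : 0 < INR (S k)) by (apply lt_0_INR; lia).
  set (n := INR (S k)) in *; set (a := fourier_cos f (S k)); set (b := fourier_sin f (S k)).
  (* Young's inequality for the product of n^2 |c| and 1/n. *)
  assert (AG : forall c, n * Rabs c <= / 2 * (n ^ 2 * c) ^ 2 + / 2 * / n ^ 2).
  { intros c.
    assert (0 <= (n ^ 2 * Rabs c - / n) ^ 2) by apply pow2_ge_0.
    replace ((n ^ 2 * c) ^ 2) with ((n ^ 2 * Rabs c) ^ 2)
      by (rewrite !Rpow_mult_distr, pow2_abs; reflexivity).
    replace ((n ^ 2 * Rabs c - / n) ^ 2) with
      ((n ^ 2 * Rabs c) ^ 2 - 2 * (n * Rabs c) + / n ^ 2) in H by (field; lra).
    lra. }
  generalize (AG a) (AG b).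
  replace ((n * - (n * a)) ^ 2) with ((n ^ 2 * a) ^ 2) by ring.
  replace ((- (n * (n * b))) ^ 2) with ((n ^ 2 * b) ^ 2) by ring. lra. }
apply Rle_trans with (1 := psum_le _ _ N H).
rewrite !psum_plus, !psum_scal.
generalize (psum_inv_sqr N) (fourier_cos_bessel _ N Hc) (fourier_sin_bessel _ N Hc).
fold B; lra.
Qed.

Definition fourier_term (f : R -> R) (n : nat) (x : R) : R :=
  fourier_cos f n * cos (INR n * x) + fourier_sin f n * sin (INR n * x).

Lemma fourier_term_bound f k x : Rabs (fourier_term f (S k) x) <= coef_size f k.
Proof.
unfold fourier_term, coef_size.
apply Rle_trans with (1 := Rabs_triang _ _); rewrite !Rabs_mult.
assert (Hc : Rabs (cos (INR (S k) * x)) <= 1) by (apply Rabs_le, COS_bound).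
assert (Hs : Rabs (sin (INR (S k) * x)) <= 1) by (apply Rabs_le, SIN_bound).
generalize (Rabs_pos (fourier_cos f (S k))) (Rabs_pos (fourier_sin f (S k))); nra.
Qed.

Lemma fourier_term_kernel f n x : cont f ->
  fourier_term f n x = / PI * period_int (fun t => f t * cos (INR n * (t - x))).
Proof.
intros Hf; unfold fourier_term, fourier_cos, fourier_sin.
fold (period_int (fun t => f t * cos (INR n * t)));
  fold (period_int (fun t => f t * sin (INR n * t))).
rewrite (period_int_ext (fun t => f t * cos (INR n * (t - x)))
  (fun t => cos (INR n * x) * (f t * cos (INR n * t))
            + sin (INR n * x) * (f t * sin (INR n * t)))).
- rewrite period_int_plus, !period_int_scal; auto with cont; ring.
- intros t; rewrite Rmult_minus_distr_l, cos_minus; ring.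
Qed.

Definition fourier_sum (f : R -> R) (N : nat) (x : R) : R :=
  mean f + psum (fun k => fourier_term f (S k) x) N.

(** * Fejér's theorem *)

Definition dirichlet (N : nat) (s : R) : R :=
  1 + psum (fun k => 2 * cos (INR (S k) * s)) N.

Definition fejer (M : nat) (s : R) : R := psum (fun N => dirichlet N s) M.

(** Multiplied by 1 - cos s, each Dirichlet kernel becomes the difference of two consecutive
    cosines, so their sum telescopes. The product form also covers the multiples of 2 pi. There is
    no factor 1/M in [fejer]: its integral over a period is 2 pi M. *)
Lemma fejer_closed_form M s : (1 - cos s) * fejer M s = 1 - cos (INR M * s).
Proof.
assert (D : forall N, (1 - cos s) * dirichlet N s = cos (INR N * s) - cos (INR (S N) * s)).
{ unfold dirichlet; induction N as [|N IH].
  - simpl; rewrite Rmult_0_l, Rmult_1_l, cos_0; ring.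
  - rewrite psum_S, <- Rplus_assoc, Rmult_plus_distr_l, IH.
    replace (INR (S (S N)) * s) with (INR (S N) * s + s) by (rewrite (S_INR (S N)); ring).
    replace (INR N * s) with (INR (S N) * s - s) by (rewrite (S_INR N); ring).
    rewrite cos_plus, cos_minus; ring. }
unfold fejer; induction M as [|M IH].
- simpl; rewrite Rmult_0_l, cos_0; ring.
- rewrite psum_S, Rmult_plus_distr_l, IH, D; ring.
Qed.

(** The closed form decides the sign except where cos s = 1; there every cosine in the sum equals
    1. *)
Lemma fejer_pos M s : 0 <= fejer M s.
Proof.
destruct (Req_dec (cos s) 1) as [H|H].
- assert (Hs : sin s = 0).
  { generalize (sin2_cos2 s); unfold Rsqr; rewrite H; nra. }
  assert (Hc : forall n, cos (INR n * s) = 1 /\ sin (INR n * s) = 0).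
  { induction n as [|n [IH1 IH2]].
    - simpl; rewrite Rmult_0_l, cos_0, sin_0; auto.
    - rewrite S_INR, Rmult_plus_distr_r, Rmult_1_l, cos_plus, sin_plus, IH1, IH2, H, Hs.
      split; ring. }
  assert (Hd : forall N, 0 <= dirichlet N s).
  { intros N; unfold dirichlet.
    enough (0 <= psum (fun k => 2 * cos (INR (S k) * s)) N) by lra.
    apply (psum_mono (fun k => 2 * cos (INR (S k) * s)) 0 N); [|lia].
    intros k; rewrite (proj1 (Hc (S k))); lra. }
  apply (psum_mono (fun N => dirichlet N s) 0 M); auto; lia.
- assert (Hlt : 0 < 1 - cos s) by (generalize (COS_bound s); lra).
  apply Rmult_le_reg_l with (1 := Hlt).
  rewrite fejer_closed_form, Rmult_0_r; generalize (COS_bound (INR M * s)); lra.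
Qed.

Lemma cont_dirichlet N x : cont (fun t => dirichlet N (t - x)).
Proof.
unfold dirichlet; auto with cont.
Qed.

Lemma cont_fejer M x : cont (fun t => fejer M (t - x)).
Proof. apply (cont_psum (fun N t => dirichlet N (t - x))); intros N; apply cont_dirichlet. Qed.

#[local] Hint Resolve cont_dirichlet cont_fejer : cont.

Lemma fourier_sum_kernel f N x : cont f ->
  2 * PI * fourier_sum f N x = period_int (fun t => f t * dirichlet N (t - x)).
Proof.
intros Hf; assert (HPI := PI_RGT_0).
rewrite (period_int_ext _
  (fun t => f t + psum (fun k => 2 * (f t * cos (INR (S k) * (t - x)))) N)).
2:{ intros t; unfold dirichlet; rewrite Rmult_plus_distr_l, Rmult_1_r, <- psum_scal.
    f_equal; apply psum_ext; intros; ring. }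
rewrite period_int_plus; auto with cont.
rewrite (period_int_psum (fun k t => 2 * (f t * cos (INR (S k) * (t - x))))); auto with cont.
unfold fourier_sum; rewrite Rmult_plus_distr_l; f_equal.
- unfold mean; fold (period_int f); field; lra.
- rewrite <- psum_scal; apply psum_ext; intros k.
  rewrite fourier_term_kernel, period_int_scal; auto with cont; field; lra.
Qed.

Lemma period_int_dirichlet N x : period_int (fun t => dirichlet N (t - x)) = 2 * PI.
Proof.
assert (HPI := PI_RGT_0).
unfold dirichlet.
rewrite period_int_plus, period_int_const; auto with cont.
rewrite (period_int_psum (fun k t => 2 * cos (INR (S k) * (t - x)))); auto with cont.
enough (psum (fun k => period_int (fun t => 2 * cos (INR (S k) * (t - x)))) N = 0) by lra.
induction N as [|N IH]; [reflexivity|].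
rewrite psum_S, IH, period_int_scal; auto with cont.
assert (Hn : 0 < INR (S N)) by (apply lt_0_INR; lia).
assert (Hs := sin_nat_2PI (S N)); assert (Hc := cos_nat_2PI (S N)).
set (n := INR (S N)) in *.
rewrite (period_int_derive (fun t => / n * sin (n * (t - x)))); auto with cont.
- rewrite !Rmult_minus_distr_l, !sin_minus, Hs, Hc, !Rmult_0_r, sin_0, cos_0.
  ring.
- intros t; auto_derive; auto; unfold Rminus; field; lra.
Qed.

Lemma periodic_nat f x n : periodic f -> f (x + INR n * (2 * PI)) = f x.
Proof.
intros H; induction n as [|n IH].
- simpl; f_equal; ring.
- rewrite S_INR.
  replace (x + (INR n + 1) * (2 * PI)) with (x + INR n * (2 * PI) + 2 * PI) by ring.
  now rewrite H.
Qed.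

Lemma periodic_IZR f x z : periodic f -> f (x + IZR z * (2 * PI)) = f x.
Proof.
intros H; destruct (Z.le_gt_cases 0 z) as [Hz|Hz].
- rewrite <- (Z2Nat.id z), <- INR_IZR_INZ by lia; now apply periodic_nat.
- rewrite <- (periodic_nat f _ (Z.to_nat (- z)) H), INR_IZR_INZ, Z2Nat.id, opp_IZR by lia.
  f_equal; ring.
Qed.

Lemma period_reduce (a x : R) : exists z : Z, a <= x + IZR z * (2 * PI) <= a + 2 * PI.
Proof.
assert (HPI := PI_RGT_0).
exists (- Int_part ((x - a) / (2 * PI)))%Z.
destruct (base_Int_part ((x - a) / (2 * PI))) as [H1 H2].
rewrite opp_IZR; set (q := IZR (Int_part _)) in *.
assert (Hx : x - a = (x - a) / (2 * PI) * (2 * PI)) by (field; lra).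
set (r := (x - a) / (2 * PI)) in *.
assert (0 <= (r - q) * (2 * PI)) by (apply Rmult_le_pos; lra).
assert (0 <= (1 - (r - q)) * (2 * PI)) by (apply Rmult_le_pos; lra).
lra.
Qed.

(** The majorant is shaped for [fejer_closed_form]: against the kernel, the factor 1 - cos (t - x)
    gives at most 2 whatever M is, so the possibly huge [C] disappears after division by M. Near [x]
    continuity gives [eps]; elsewhere 1 - cos is bounded below. *)
Lemma fejer_majorant f x eps : cont f -> periodic f -> 0 < eps ->
  exists C, 0 <= C /\ forall t, Rabs (f t - f x) <= eps + C * (1 - cos (t - x)).
Proof.
intros Hf Hp Heps; assert (HPI := PI_RGT_0).
destruct (proj1 (filterlim_locally f (f x)) (Hf x) (mkposreal _ Heps)) as [delta Hdelta].
destruct (continuity_ab_maj (fun t => Rabs (f t - f x)) (x - PI) (x + PI)) as [tm [Htm _]].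
{ lra. }
{ intros c _; apply continuity_pt_filterlim, (cont_abs (fun t => f t - f x)).
  auto with cont. }
set (B := Rabs (f tm - f x)) in *.
assert (HB : 0 <= B) by apply Rabs_pos.
(* Capped at [PI] so that the cosine is decreasing on the range of distances considered. *)
set (del := Rmin delta PI).
assert (Hdel : 0 < del <= PI).
{ unfold del; split; [apply Rmin_pos; [apply delta|lra]|apply Rmin_r]. }
assert (Hcos : 0 < 1 - cos del).
{ rewrite <- cos_0; generalize (cos_decreasing_1 0 del); lra. }
assert (Hpos : 0 <= B / (1 - cos del)).
{ apply Rmult_le_pos; [exact HB|left; apply Rinv_0_lt_compat, Hcos]. }
exists (B / (1 - cos del)); split; [exact Hpos|intros t].
destruct (period_reduce (x - PI) t) as [z Hz].
rewrite <- (periodic_IZR f t z Hp).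
replace (cos (t - x)) with (cos (t + IZR z * (2 * PI) - x)).
2:{ assert (Hc : periodic (fun s => cos (s - x))).
    { intros s; replace (s + 2 * PI - x) with (s - x + 2 * INR 1 * PI) by (simpl; ring).
      apply cos_period. }
    apply (periodic_IZR _ t z Hc). }
set (s := t + _) in *.
assert (Hcb := COS_bound (s - x)).
destruct (Rlt_le_dec (Rabs (s - x)) del) as [Hs|Hs].
- assert (Hb : ball x delta s).
  { apply Rlt_le_trans with (1 := Hs); apply Rmin_l. }
  generalize (Hdelta s Hb); unfold ball; simpl; unfold AbsRing_ball, abs, minus, plus, opp; simpl.
  intros Hball.
  assert (0 <= B / (1 - cos del) * (1 - cos (s - x))) by (apply Rmult_le_pos; lra).
  unfold Rminus in *; lra.
- assert (Hle : cos (s - x) <= cos del).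
  { assert (Hc : cos (s - x) = cos (Rabs (s - x))).
    { unfold Rabs; destruct (Rcase_abs (s - x)); [now rewrite cos_neg|reflexivity]. }
    assert (Rabs (s - x) <= PI) by (apply Rabs_le; lra).
    rewrite Hc; apply cos_decr_1; lra. }
  assert (Hm : Rabs (f s - f x) <= B) by (apply Htm; lra).
  assert (B <= B / (1 - cos del) * (1 - cos (s - x))); [|lra].
  replace B with (B / (1 - cos del) * (1 - cos del)) at 1 by (field; lra).
  apply Rmult_le_compat_l; lra.
Qed.

(** The summed errors are the integral of [f t - f x] against the Fejér kernel. As the kernel is
    positive, the majorant may be inserted: [eps] meets the total mass 2 pi M, and the cosine part
    contributes at most 2 [C] pointwise. *)
Lemma fourier_sum_cesaro f x eps : cont f -> periodic f -> 0 < eps ->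
  exists C, forall M, Rabs (psum (fun N => fourier_sum f N x - f x) M) <= eps * INR M + C.
Proof.
intros Hf Hp Heps; assert (HPI := PI_RGT_0).
destruct (fejer_majorant f x eps Hf Hp Heps) as [C [HC Hmaj]].
exists (2 * C); intros M.
assert (Hint : 2 * PI * psum (fun N => fourier_sum f N x - f x) M =
  period_int (fun t => (f t - f x) * fejer M (t - x))).
{ rewrite <- psum_scal.
  rewrite (period_int_ext _ (fun t => psum (fun N => (f t - f x) * dirichlet N (t - x)) M))
    by (intros t; now rewrite psum_scal).
  rewrite (period_int_psum (fun N t => (f t - f x) * dirichlet N (t - x))); auto with cont.
  apply psum_ext; intros N.
  rewrite Rmult_minus_distr_l, fourier_sum_kernel; auto.
  rewrite (period_int_ext (fun t => (f t - f x) * dirichlet N (t - x))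
    (fun t => f t * dirichlet N (t - x) - f x * dirichlet N (t - x)))
    by (intros; ring).
  rewrite period_int_minus, period_int_scal, period_int_dirichlet; auto with cont; ring. }
assert (HF : period_int (fun t => fejer M (t - x)) = 2 * PI * INR M).
{ unfold fejer; rewrite (period_int_psum (fun N t => dirichlet N (t - x))); auto with cont.
  induction M as [|M IH]; [simpl; ring|].
  rewrite psum_S, period_int_dirichlet, S_INR.
  assert (E : psum (fun k => period_int (fun t => dirichlet k (t - x))) M = 2 * PI * INR M).
  { clear; induction M as [|M IH]; [simpl; ring|].
    rewrite psum_S, IH, period_int_dirichlet, S_INR; ring. }
  rewrite E; ring. }
apply Rmult_le_reg_l with (2 * PI); [lra|].
rewrite <- (Rabs_pos_eq (2 * PI)) at 1 by lra.
rewrite <- Rabs_mult, Hint.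
assert (Hcont : cont (fun t => (f t - f x) * fejer M (t - x))) by auto with cont.
apply Rle_trans with (1 := period_int_abs _ Hcont).
apply Rle_trans with (period_int (fun t => eps * fejer M (t - x) + 2 * C)).
- apply period_int_le; auto with cont; intros t.
  rewrite Rabs_mult, (Rabs_pos_eq (fejer M (t - x))) by apply fejer_pos.
  assert (Hb := Hmaj t).
  apply Rle_trans with ((eps + C * (1 - cos (t - x))) * fejer M (t - x)).
  + apply Rmult_le_compat_r; [apply fejer_pos|exact Hb].
  + rewrite Rmult_plus_distr_r, Rmult_assoc, fejer_closed_form.
    generalize (COS_bound (INR M * (t - x))); nra.
- rewrite period_int_plus, period_int_scal, HF, period_int_const; auto with cont.
  right; ring.
Qed.

(** Absolute summability of the coefficients provides some limit; the Cesàro means of the errors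
    share it, and the Fejér estimate forces it to be zero. *)
Lemma fourier_sum_lim f x : C2_periodic f -> is_lim_seq (fun N => fourier_sum f N x) (f x).
Proof.
intros HC2; assert (HC2' := HC2); destruct HC2' as [Hp Hd _ _].
assert (Hf := derivable_cont f Hd).
destruct (coef_size_summable f HC2) as [W HW].
assert (Hser : ex_series (fun k => fourier_term f (S k) x)).
{ apply (ex_series_dominated _ (fun k => INR (S k) * coef_size f k) W); auto.
  intros k; apply Rle_trans with (1 := fourier_term_bound f k x).
  assert (1 <= INR (S k)) by (rewrite S_INR; generalize (pos_INR k); lra).
  generalize (coef_size_pos f k); nra. }
destruct Hser as [l Hl].
apply is_series_psum in Hl.
assert (Hlim : is_lim_seq (fun N => fourier_sum f N x - f x) (mean f + l - f x)).
{ apply (is_lim_seq_minus' _ _ (mean f + l)); [|apply is_lim_seq_const].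
  apply (is_lim_seq_plus' (fun _ => mean f)); [apply is_lim_seq_const|exact Hl]. }
set (ell := mean f + l - f x) in *.
assert (Hell : ell = 0).
{ apply cond_eq; intros eps Heps.
  rewrite Rminus_0_r.
  destruct (fourier_sum_cesaro f x (eps / 2) Hf Hp ltac:(lra)) as [C HC].
  assert (HCes : Un_cv (fun n => sum_f_R0 (fun N => fourier_sum f N x - f x) (Init.Nat.pred n)
                                 / INR n) ell)
    by now apply Cesaro_1, is_lim_seq_Reals.
  apply is_lim_seq_Reals, is_lim_seq_abs in HCes.
  assert (Hup : is_lim_seq (fun n => eps / 2 + C * / INR n) (eps / 2 + C * 0)).
  { apply (is_lim_seq_plus' (fun _ => eps / 2)); [apply is_lim_seq_const|].
    apply (is_lim_seq_scal_l (fun n => / INR n) C 0).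
    apply (is_lim_seq_inv INR p_infty); [apply is_lim_seq_INR|discriminate]. }
  assert (Hle : Rbar_le (Rabs ell) (eps / 2 + C * 0)).
  { refine (is_lim_seq_le_loc _ _ _ _ _ HCes Hup).
    (* The Cesàro lemma sums up to [pred n], which is [n] terms only for n >= 1; index 0 is
       discarded. *)
    exists 1%nat; intros n Hn.
    assert (Hn' : 0 < INR n) by (apply lt_0_INR; lia).
    rewrite Rabs_div, (Rabs_pos_eq (INR n)) by lra.
    replace (sum_f_R0 _ _) with (psum (fun N => fourier_sum f N x - f x) n).
    2:{ destruct n as [|n]; [lia|]; simpl Init.Nat.pred.
        now rewrite <- sum_n_psum, sum_n_Reals. }
    apply Rmult_le_reg_r with (INR n); [lra|].
    unfold Rdiv; rewrite Rmult_assoc, Rinv_l, Rmult_1_r by lra.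
    apply Rle_trans with (1 := HC n); right; field; lra. }
  simpl in Hle; lra. }
unfold ell in Hell.
replace (f x) with (ell + f x) by (unfold ell; lra).
apply (is_lim_seq_ext (fun N => fourier_sum f N x - f x + f x)); [intros; ring|].
apply is_lim_seq_plus'; [exact Hlim|apply is_lim_seq_const].
Qed.

(** * The minimum principle in the strip *)

Lemma continuity_2d_pt_slice v x y :
  continuity_2d_pt v x y -> continuity_pt (fun t => v t y) x.
Proof.
intros H; apply continuity_pt_locally; intros eps.
destruct (H eps) as [delta Hdelta]; exists delta; intros t Ht.
apply Hdelta; [exact Ht|rewrite Rminus_diag, Rabs_R0; apply delta].
Qed.

(** Minimize in [x] on each horizontal slice, then minimize the resulting function of [y]. That
    function is continuous because uniform continuity of [v] moves all slice values together. *)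
Lemma rectangle_min v a b c e : a <= b -> c <= e ->
  (forall x y, continuity_2d_pt v x y) ->
  exists x0 y0, a <= x0 <= b /\ c <= y0 <= e /\
    forall x y, a <= x <= b -> c <= y <= e -> v x0 y0 <= v x y.
Proof.
intros Hab Hce Hv.
assert (Hslice : forall y, exists x0, (forall x, a <= x <= b -> v x0 y <= v x y) /\ a <= x0 <= b).
{ intros y; apply (continuity_ab_min (fun t => v t y)); auto.
  intros; now apply continuity_2d_pt_slice. }
set (s := fun y => proj1_sig (constructive_indefinite_description _ (Hslice y))).
assert (Hs : forall y, (forall x, a <= x <= b -> v (s y) y <= v x y) /\ a <= s y <= b).
{ intros y; unfold s; apply proj2_sig. }
destruct (continuity_ab_min (fun y => v (s y) y) c e Hce) as [y0 [Hy0 Hy0']].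
- intros y Hy; apply continuity_pt_locally; intros eps.
  (* The interval in [y] is widened by 1 because continuity at an endpoint also looks at points
     outside of it. *)
  destruct (uniform_continuity_2d v a b (c - 1) (e + 1) (fun x y _ _ => Hv x y) eps)
    as [delta Hdelta].
  assert (Hpos : 0 < Rmin delta 1) by (apply Rmin_pos; [apply delta|lra]).
  exists (mkposreal _ Hpos); intros y' Hy'.
  change (Rabs (y' - y) < Rmin delta 1) in Hy'.
  assert (H1 := Rlt_le_trans _ _ _ Hy' (Rmin_l _ _)).
  assert (H2 := Rlt_le_trans _ _ _ Hy' (Rmin_r _ _)).
  apply Rabs_def2 in H2.
  assert (Hclose : forall x, a <= x <= b -> Rabs (v x y' - v x y) < eps).
  { intros x Hx; apply Hdelta; try lra.
    rewrite Rminus_diag, Rabs_R0; apply delta. }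
  destruct (Hs y) as [Hm Hr]; destruct (Hs y') as [Hm' Hr'].
  generalize (Hm _ Hr') (Hm' _ Hr) (Rabs_def2 _ _ (Hclose _ Hr)) (Rabs_def2 _ _ (Hclose _ Hr')).
  intros; apply Rabs_def1; lra.
- exists (s y0), y0; split; [apply Hs|split; [exact Hy0'|]].
  intros x y Hx Hy; apply Rle_trans with (1 := Hy0 y Hy); now apply Hs.
Qed.

(** At the minimum [f'] vanishes; if [l] were negative, [f'] would be negative just to the right,
    and the mean value theorem would produce a smaller value of [f]. *)
Lemma local_min_second_derivative (f f' : R -> R) (x l r : R) : 0 < r ->
  (forall t, Rabs (t - x) < r -> is_derive f t (f' t)) -> is_derive f' x l ->
  (forall t, Rabs (t - x) < r -> f x <= f t) -> 0 <= l.
Proof.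
intros Hr Hf Hf' Hmin.
assert (Hx : is_derive f x (f' x)) by (apply Hf; rewrite Rminus_diag, Rabs_R0; exact Hr).
assert (Hzero : f' x = 0).
{ assert (Hpt : derivable_pt_lim f x (f' x)) by now apply is_derive_Reals.
  rewrite <- (deriv_minimum f (x - r) (x + r) x (exist _ _ Hpt)); [reflexivity|lra|lra|].
  intros t H1 H2; apply Hmin, Rabs_def1; lra. }
destruct (Rle_lt_dec 0 l) as [H|Hl]; [exact H|exfalso].
apply is_derive_Reals in Hf'.
destruct (Hf' (- l) ltac:(lra)) as [delta Hdelta].
set (h := Rmin delta r / 2).
assert (Hh : 0 < h /\ h < delta /\ h < r).
{ assert (0 < Rmin delta r) by (apply Rmin_pos; [apply delta|exact Hr]).
  generalize (Rmin_l delta r) (Rmin_r delta r); unfold h; lra. }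
destruct (MVT_cor2 f f' x (x + h)) as [c [Hc Hc']]; [lra| |].
{ intros t Ht; apply is_derive_Reals, Hf, Rabs_def1; lra. }
assert (Hneg : f' c < 0).
{ specialize (Hdelta (c - x) ltac:(lra)).
  replace (x + (c - x)) with c in Hdelta by ring.
  assert (Hq : (f' c - f' x) / (c - x) < 0).
  { assert (Rabs (c - x) < delta) as Ha by (apply Rabs_def1; lra).
    destruct (Rabs_def2 _ _ (Hdelta Ha)); lra. }
  rewrite Hzero, Rminus_0_r in Hq.
  replace (f' c) with (f' c / (c - x) * (c - x)) by (field; lra).
  nra. }
assert (f x <= f (x + h)) by (apply Hmin, Rabs_def1; lra).
nra.
Qed.

(** Required on the whole plane, as holds for finite sums of modes; a minimum over the periodic
    strip can then sit on a lateral side of the chosen rectangle without special treatment. *)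
Definition harmonic (v : R -> R -> R) : Prop :=
  (forall x y, continuity_2d_pt v x y) /\
  exists vx vy vxx vyy : R -> R -> R,
    (forall x y, is_derive (fun t => v t y) x (vx x y)) /\
    (forall x y, is_derive (fun t => v x t) y (vy x y)) /\
    (forall x y, is_derive (fun t => vx t y) x (vxx x y)) /\
    (forall x y, is_derive (fun t => vy x t) y (vyy x y)) /\
    (forall x y, vxx x y + vyy x y = 0).

Lemma harmonic_plus u v : harmonic u -> harmonic v -> harmonic (fun x y => u x y + v x y).
Proof.
intros [Hu (ux & uy & uxx & uyy & U1 & U2 & U3 & U4 & U5)]
       [Hv (vx & vy & vxx & vyy & V1 & V2 & V3 & V4 & V5)].
split; [intros; now apply continuity_2d_pt_plus|].
exists (fun x y => ux x y + vx x y), (fun x y => uy x y + vy x y),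
       (fun x y => uxx x y + vxx x y), (fun x y => uyy x y + vyy x y).
refine (conj _ (conj _ (conj _ (conj _ _)))); intros x y.
- now apply (is_derive_plus (fun t => u t y) (fun t => v t y)).
- now apply (is_derive_plus (fun t => u x t) (fun t => v x t)).
- now apply (is_derive_plus (fun t => ux t y) (fun t => vx t y)).
- now apply (is_derive_plus (fun t => uy x t) (fun t => vy x t)).
- generalize (U5 x y) (V5 x y); lra.
Qed.

(** Subtracting eps y^2 makes the Laplacian equal to -2 eps, which excludes an interior minimum.
    Periodicity turns the minimum over one rectangle into a minimum over the strip. *)
Lemma strip_minimum_principle (d : R) (v : R -> R -> R) : 0 < d -> harmonic v ->
  (forall y, periodic (fun x => v x y)) ->
  (forall x, 0 <= v x 0) -> (forall x, 0 <= v x (- d)) ->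
  forall x y, - d <= y <= 0 -> 0 <= v x y.
Proof.
intros Hd [Hcont (vx & vy & vxx & vyy & V1 & V2 & V3 & V4 & V5)] Hper Htop Hbot x1 y1 Hy1.
destruct (Rle_lt_dec 0 (v x1 y1)) as [H|Hneg]; [exact H|exfalso].
assert (HPI := PI_RGT_0).
(* With this choice the perturbation is at most half of [- v x1 y1] in the strip, so the bottom
   values stay above the negative value assumed at the interior point. *)
set (eps := - v x1 y1 / (2 * d ^ 2)).
assert (Hd2 : 0 < d ^ 2) by (apply pow_lt, Hd).
assert (Heps : 0 < eps) by (apply Rdiv_lt_0_compat; lra).
assert (Heps' : eps * d ^ 2 = - v x1 y1 / 2) by (unfold eps; field; lra).
set (w := fun x y => v x y - eps * (y * y)).
assert (Hw : forall x y, continuity_2d_pt w x y).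
{ intros x y; apply continuity_2d_pt_minus; [apply Hcont|].
  repeat apply continuity_2d_pt_mult; (apply continuity_2d_pt_const || apply continuity_2d_pt_id2). }
destruct (rectangle_min w 0 (2 * PI) (- d) 0 ltac:(lra) ltac:(lra) Hw)
  as (x0 & y0 & Hx0 & Hy0 & Hmin).
assert (Hmin' : forall x y, - d <= y <= 0 -> w x0 y0 <= w x y).
{ intros x y Hy; destruct (period_reduce 0 x) as [z Hz].
  replace (w x y) with (w (x + IZR z * (2 * PI)) y).
  - apply Hmin; [lra|exact Hy].
  - unfold w; f_equal; apply (periodic_IZR (fun x => v x y) x z (Hper y)). }
assert (Hw1 : w x0 y0 <= v x1 y1).
{ apply Rle_trans with (1 := Hmin' x1 y1 Hy1); unfold w.
  assert (0 <= eps * (y1 * y1)) by (apply Rmult_le_pos; nra). lra. }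
destruct (Req_dec y0 0) as [->|Hn0].
{ generalize (Htop x0); unfold w in Hw1; lra. }
destruct (Req_dec y0 (- d)) as [->|Hnd].
{ generalize (Hbot x0); unfold w in Hw1.
  replace (eps * (- d * - d)) with (eps * d ^ 2) in Hw1 by ring. lra. }
assert (Hxx : 0 <= vxx x0 y0).
{ apply (local_min_second_derivative (fun t => v t y0) (fun t => vx t y0) x0 _ 1); auto.
  - lra.
  - intros t _; generalize (Hmin' t y0 Hy0); unfold w; lra. }
assert (Hyy : 0 <= vyy x0 y0 - 2 * eps).
{ apply (local_min_second_derivative (fun t => w x0 t) (fun t => vy x0 t - 2 * eps * t) y0 _
    (Rmin (- y0) (y0 + d))).
  - apply Rmin_pos; lra.
  - intros t _; unfold w; apply (is_derive_minus (fun t => v x0 t)); [apply V2|].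
    auto_derive; auto; ring.
  - apply (is_derive_minus (fun t => vy x0 t)); [apply V4|].
    auto_derive; auto; ring.
  - intros t Ht; apply Hmin'.
    assert (H1 := Rlt_le_trans _ _ _ Ht (Rmin_l _ _)).
    assert (H2 := Rlt_le_trans _ _ _ Ht (Rmin_r _ _)).
    apply Rabs_def2 in H1; apply Rabs_def2 in H2; lra. }
generalize (V5 x0 y0); lra.
Qed.

(** * Positivity of the Dirichlet-to-Neumann operator *)

Lemma sinh_pos x : 0 < x -> 0 < sinh x.
Proof.
intros Hx; unfold sinh; generalize (exp_increasing (- x) x ltac:(lra)); lra.
Qed.

Lemma cosh_pos x : 0 < cosh x.
Proof. unfold cosh; generalize (exp_pos x) (exp_pos (- x)); lra. Qed.

Lemma cosh_mono x y : 0 <= x <= y -> cosh x <= cosh y.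
Proof.
intros [Hx [Hxy| ->]]; [|lra].
destruct (MVT_cor2 cosh sinh x y Hxy) as [c [Hc Hc']].
{ intros; apply derivable_pt_lim_cosh. }
generalize (sinh_pos c ltac:(lra)); nra.
Qed.

Lemma sinh_tangent x h : 0 <= h <= x -> 0 <= sinh x - sinh (x - h) <= h * cosh x.
Proof.
intros [[Hh| <-] Hx]; [|rewrite Rminus_0_r; lra].
destruct (MVT_cor2 sinh cosh (x - h) x ltac:(lra)) as [c [Hc Hc']].
{ intros; apply derivable_pt_lim_sinh. }
rewrite Hc; replace (x - (x - h)) with h by ring.
generalize (cosh_pos c) (cosh_mono c x ltac:(lra)); nra.
Qed.

(** The difference cosh x - sinh x is exp (-x), at most 1, and sinh x is at least x/2. This crude
    bound already gives a multiplier growing linearly in n. *)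
Lemma coth_bounds x : 0 < x -> 0 <= coth x <= 1 + 2 / x.
Proof.
intros Hx; assert (Hs := sinh_pos x Hx); assert (Hc := cosh_pos x).
unfold coth; split.
{ left; now apply Rdiv_lt_0_compat. }
assert (Hsx : x / 2 <= sinh x).
{ unfold sinh; assert (He := exp_ineq1 x ltac:(lra)).
  assert (exp (- x) <= 1) by (rewrite <- exp_0; left; apply exp_increasing; lra). lra. }
assert (Hcx : cosh x <= sinh x + 1).
{ unfold sinh, cosh.
  assert (exp (- x) <= 1) by (rewrite <- exp_0; left; apply exp_increasing; lra). lra. }
apply Rmult_le_reg_r with (sinh x); [exact Hs|].
unfold Rdiv; rewrite Rmult_assoc, Rinv_l, Rmult_1_r by lra.
assert (1 <= 2 * / x * sinh x); [|lra].
replace 1 with (2 * / x * (x / 2)) by (field; lra).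
apply Rmult_le_compat_l; [|exact Hsx].
apply Rmult_le_pos; [lra|left; now apply Rinv_0_lt_compat].
Qed.

(** The solution of p'' = n^2 p with value 0 at the bottom and 1 at the surface (n > 0); its slope
    at the surface is n coth (n d), the multiplier in [hilbert] of a derivative. *)
Definition strip_profile (d : R) (n : nat) (y : R) : R :=
  sinh (INR n * (y + d)) / sinh (INR n * d).

Lemma strip_profile_top d n : 0 < d -> strip_profile d (S n) 0 = 1.
Proof.
intros Hd; unfold strip_profile; rewrite Rplus_0_l.
apply Rinv_r, Rgt_not_eq, sinh_pos, Rmult_lt_0_compat; [apply lt_0_INR; lia|exact Hd].
Qed.

Lemma strip_profile_bottom d n : strip_profile d n (- d) = 0.
Proof.
unfold strip_profile; rewrite Rplus_opp_l, Rmult_0_r, sinh_0; unfold Rdiv; ring.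
Qed.

Lemma multiplier_bound d n : 0 < d ->
  0 <= INR (S n) * coth (INR (S n) * d) <= (1 + 2 / d) * INR (S n).
Proof.
intros Hd; assert (Hn : 1 <= INR (S n)) by (rewrite S_INR; generalize (pos_INR n); lra).
set (N := INR (S n)) in *.
destruct (coth_bounds (N * d) ltac:(nra)) as [H1 H2]; split; [nra|].
apply Rle_trans with (N * (1 + 2 / (N * d))); [apply Rmult_le_compat_l; lra|].
replace (N * (1 + 2 / (N * d))) with (N + 2 / d * 1) by (field; split; lra).
assert (0 < 2 / d) by (apply Rdiv_lt_0_compat; lra). nra.
Qed.

(** Linearity in [- y] lets the estimate survive the difference quotient at the surface, and
    linearity in n is absorbed by the weighted summability. The bound is the tangent inequality for
    sinh, convex on the positive axis. *)
Lemma strip_profile_slope d n y : 0 < d -> - d <= y <= 0 ->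
  0 <= 1 - strip_profile d (S n) y <= (1 + 2 / d) * INR (S n) * - y.
Proof.
intros Hd Hy.
assert (Hm := multiplier_bound d n Hd).
assert (Hn : 0 < INR (S n)) by (apply lt_0_INR; lia).
unfold strip_profile, coth in *; set (N := INR (S n)) in *.
assert (HNd : 0 < N * d) by now apply Rmult_lt_0_compat.
assert (Hs := sinh_pos _ HNd).
assert (Ht := sinh_tangent (N * d) (N * - y) ltac:(nra)).
replace (N * d - N * - y) with (N * (y + d)) in Ht by ring.
replace (1 - sinh (N * (y + d)) / sinh (N * d)) with
  ((sinh (N * d) - sinh (N * (y + d))) / sinh (N * d)) by (field; lra).
split.
- apply Rmult_le_pos; [lra|left; now apply Rinv_0_lt_compat].
- apply Rle_trans with (N * - y * cosh (N * d) / sinh (N * d)).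
  + apply Rmult_le_compat_r; [left; now apply Rinv_0_lt_compat|lra].
  + replace (N * - y * cosh (N * d) / sinh (N * d)) with
      (N * (cosh (N * d) / sinh (N * d)) * - y) by (field; lra).
    apply Rmult_le_compat_r; lra.
Qed.

(** The zero mode extends by an affine function of [y]; its slope is the term [mean f / d] of the
    Dirichlet-to-Neumann operator. *)
Definition strip_extension (d : R) (f : R -> R) (N : nat) (x y : R) : R :=
  mean f * (1 + y / d) + psum (fun k => strip_profile d (S k) y * fourier_term f (S k) x) N.

Lemma strip_extension_top d f N x : 0 < d -> strip_extension d f N x 0 = fourier_sum f N x.
Proof.
intros Hd; unfold strip_extension, fourier_sum; f_equal.
- field; lra.
- apply psum_ext; intros k; rewrite strip_profile_top by exact Hd; ring.
Qed.

Lemma strip_extension_bottom d f N x : 0 < d -> strip_extension d f N x (- d) = 0.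
Proof.
intros Hd; unfold strip_extension.
replace (1 + - d / d) with 0 by (field; lra).
induction N as [|N IH]; [simpl; ring|].
rewrite psum_S, strip_profile_bottom, <- Rplus_assoc, IH; ring.
Qed.

Lemma continuity_2d_pt_elementary (f g : R -> R) (x y : R) :
  continuity_pt f x -> continuity_pt g y -> continuity_2d_pt (fun u v => g v * f u) x y.
Proof.
intros Hf Hg; apply continuity_2d_pt_mult.
- apply (continuity_1d_2d_pt_comp g (fun _ v => v)); [exact Hg|apply continuity_2d_pt_id2].
- apply (continuity_1d_2d_pt_comp f (fun u _ => u)); [exact Hf|apply continuity_2d_pt_id1].
Qed.

Lemma ex_derive_continuity_pt (f : R -> R) x : ex_derive f x -> continuity_pt f x.
Proof. intros H; now apply continuity_pt_filterlim, (ex_derive_continuous f). Qed.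

Lemma harmonic_affine a b : harmonic (fun _ y => a + b * y).
Proof.
split.
- intros x y; apply continuity_2d_pt_plus; [apply continuity_2d_pt_const|].
  apply continuity_2d_pt_mult; [apply continuity_2d_pt_const|apply continuity_2d_pt_id2].
- exists (fun _ _ => 0), (fun _ _ => b), (fun _ _ => 0), (fun _ _ => 0).
  refine (conj _ (conj _ (conj _ (conj _ _)))); intros x y; try (auto_derive; auto; ring); ring.
Qed.

Lemma harmonic_mode d f n : 0 < d ->
  harmonic (fun x y => strip_profile d (S n) y * fourier_term f (S n) x).
Proof.
intros Hd.
assert (Hs : sinh (INR (S n) * d) <> 0).
{ apply Rgt_not_eq, sinh_pos, Rmult_lt_0_compat; [apply lt_0_INR; lia|exact Hd]. }
unfold strip_profile, fourier_term.
set (N := INR (S n)) in *; set (a := fourier_cos f (S n)); set (b := fourier_sin f (S n)).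
set (q := sinh (N * d)) in *.
split.
- intros x y; apply (continuity_2d_pt_elementary
    (fun x => a * cos (N * x) + b * sin (N * x)) (fun y => sinh (N * (y + d)) / q));
    apply ex_derive_continuity_pt; unfold sinh; auto_derive; auto.
- exists (fun x y => sinh (N * (y + d)) / q * (N * (b * cos (N * x) - a * sin (N * x)))),
         (fun x y => N * cosh (N * (y + d)) / q * (a * cos (N * x) + b * sin (N * x))),
         (fun x y => - (N * N * (sinh (N * (y + d)) / q * (a * cos (N * x) + b * sin (N * x))))),
         (fun x y => N * N * (sinh (N * (y + d)) / q * (a * cos (N * x) + b * sin (N * x)))).
  refine (conj _ (conj _ (conj _ (conj _ _)))); intros x y; try ring;
    unfold sinh, cosh; auto_derive; auto; rewrite ?Ropp_mult_distr_r_reverse; field; auto.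
Qed.

Lemma harmonic_strip_extension d f N c : 0 < d ->
  harmonic (fun x y => strip_extension d f N x y + c).
Proof.
intros Hd.
assert (H : forall v w, (forall x y, v x y = w x y) -> harmonic v -> harmonic w).
{ intros v w E Hv.
  replace w with v; [exact Hv|].
  apply FunctionalExtensionality.functional_extensionality; intros x.
  apply FunctionalExtensionality.functional_extensionality; intros y; apply E. }
unfold strip_extension; induction N as [|N IH].
- apply (H (fun _ y => (mean f + c) + (mean f / d) * y)); [|apply harmonic_affine].
  intros x y; simpl; field; lra.
- refine (H _ _ _ (harmonic_plus _ _ IH (harmonic_mode d f N Hd))).
  intros x y; rewrite psum_S; ring.
Qed.

Lemma periodic_strip_extension d f N c y :
  periodic (fun x => strip_extension d f N x y + c).
Proof.
intros x; unfold strip_extension; do 2 f_equal; apply psum_ext; intros k.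
f_equal; unfold fourier_term.
rewrite Rmult_plus_distr_l, cos_plus, sin_plus, sin_nat_2PI, cos_nat_2PI; ring.
Qed.

(** The slack [c] is there because partial sums of a nonnegative function may dip below zero. *)
Lemma strip_extension_lower_bound d f N c : 0 < d -> 0 <= c ->
  (forall x, - c <= fourier_sum f N x) ->
  forall x y, - d <= y <= 0 -> - c <= strip_extension d f N x y.
Proof.
intros Hd Hc Hb x y Hy.
enough (0 <= strip_extension d f N x y + c) by lra.
apply (strip_minimum_principle d (fun x y => strip_extension d f N x y + c)); auto.
- now apply harmonic_strip_extension.
- intros; apply periodic_strip_extension.
- intros t; rewrite strip_extension_top by exact Hd; generalize (Hb t); lra.
- intros t; rewrite strip_extension_bottom by exact Hd; lra.
Qed.

(** Integration by parts swaps cosine and sine coefficients and [hilbert] swaps them back, so only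
    the multiplier n coth (n d) is left. *)
Lemma hilbert_derive d f x : C2_periodic f ->
  hilbert d (Derive f) x =
  Series (fun k => INR (S k) * coth (INR (S k) * d) * fourier_term f (S k) x).
Proof.
intros [Hp Hd Hd2 _]; assert (Hc := derivable_cont _ Hd2).
unfold hilbert; apply Series_ext; intros k; cbv zeta.
rewrite fourier_cos_derive, fourier_sin_derive; auto.
unfold fourier_term; ring.
Qed.

Lemma hilbert_derive_term_bound d f k x : 0 < d ->
  Rabs (INR (S k) * coth (INR (S k) * d) * fourier_term f (S k) x)
    <= (1 + 2 / d) * (INR (S k) * coef_size f k).
Proof.
intros Hd; rewrite Rabs_mult.
destruct (multiplier_bound d k Hd) as [H1 H2].
rewrite (Rabs_pos_eq (INR (S k) * coth _)) by exact H1.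
rewrite <- Rmult_assoc; apply Rmult_le_compat; auto using Rabs_pos, fourier_term_bound.
Qed.

Lemma hilbert_derive_summable d f x : 0 < d -> C2_periodic f ->
  ex_series (fun k => INR (S k) * coth (INR (S k) * d) * fourier_term f (S k) x).
Proof.
intros Hd Hf; destruct (coef_size_summable f Hf) as [W HW].
apply (ex_series_dominated _ (fun k => (1 + 2 / d) * (INR (S k) * coef_size f k))
  ((1 + 2 / d) * W)).
- intros; now apply hilbert_derive_term_bound.
- intros N; rewrite psum_scal; apply Rmult_le_compat_l, HW.
  assert (0 < 2 / d) by (apply Rdiv_lt_0_compat; lra); lra.
Qed.

(** Division by the negative [y] turns the lower bound on the increment into an upper bound on the
    slope. *)
Lemma derive_at_right_end (phi : R -> R) (l T d : R) : 0 < d -> is_derive phi 0 l ->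
  (forall y, - d <= y <= 0 -> T * y <= phi y - phi 0) -> l <= T.
Proof.
intros Hd Hl H; apply is_derive_Reals in Hl.
apply Rnot_lt_le; intros HT.
destruct (Hl (l - T) ltac:(lra)) as [delta Hdelta].
set (h := Rmin delta d / 2).
assert (Hh : 0 < h /\ h < delta /\ h < d).
{ assert (0 < Rmin delta d) by (apply Rmin_pos; [apply delta|exact Hd]).
  generalize (Rmin_l delta d) (Rmin_r delta d); unfold h; lra. }
assert (Ha : Rabs (- h) < delta) by (apply Rabs_def1; lra).
destruct (Rabs_def2 _ _ (Hdelta (- h) ltac:(lra) Ha)) as [_ H2].
rewrite Rplus_0_l in H2.
specialize (H (- h) ltac:(lra)).
assert (T < (phi (- h) - phi 0) / - h) by lra.
assert (E : phi (- h) - phi 0 = (phi (- h) - phi 0) / - h * - h) by (field; lra).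
set (s := (phi (- h) - phi 0) / - h) in *; nra.
Qed.

(* The harmonic extension of [f] to the strip, vanishing at the bottom, is
   nonnegative, so its normal derivative [mean f / d + hilbert d (Derive f)]
   is nonpositive where [f] vanishes. *)
Lemma hilbert_derive_at_zero d f x0 : 0 < d -> C2_periodic f ->
  (forall x, 0 <= f x) -> f x0 = 0 ->
  hilbert d (Derive f) x0 <= - (mean f / d).
Proof.
intros Hd Hf Hpos Hzero.
set (v := fun k => INR (S k) * coef_size f k).
set (c := fun k => fourier_term f (S k) x0).
assert (Hv : forall k, Rabs (c k) <= v k).
{ intros k; apply Rle_trans with (1 := fourier_term_bound f k x0); unfold v.
  assert (1 <= INR (S k)) by (rewrite S_INR; generalize (pos_INR k); lra).
  generalize (coef_size_pos f k); nra. }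
assert (Hv0 : forall k, 0 <= v k).
{ intros k; apply Rle_trans with (2 := Hv k), Rabs_pos. }
assert (HK : 0 < 1 + 2 / d) by (assert (0 < 2 / d) by (apply Rdiv_lt_0_compat; lra); lra).
set (K := 1 + 2 / d) in *.
destruct (coef_size_summable f Hf) as [B HB].
destruct (ex_finite_lim_seq_incr (psum v) B) as [W HW].
{ intros n; rewrite psum_S; generalize (Hv0 n); lra. }
{ exact HB. }
(* The weighted tail: it dominates the uniform distance from [f] to its partial sums and, times
   [K |y|], the change of the vertical increment when further modes are added. *)
set (t := fun N => W - psum v N).
assert (HtW : forall N, psum v N <= W).
{ apply is_lim_seq_incr_compare with (1 := HW).
  intros n; rewrite psum_S; generalize (Hv0 n); lra. }
assert (Ht0 : is_lim_seq t 0).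
{ replace 0 with (W - W) by ring.
  apply (is_lim_seq_minus' (fun _ => W)); [apply is_lim_seq_const|exact HW]. }
assert (Htail : forall N x, Rabs (f x - fourier_sum f N x) <= t N).
{ intros N x.
  assert (Hlim : is_lim_seq (fun M => Rabs (fourier_sum f M x - fourier_sum f N x))
                            (Rabs (f x - fourier_sum f N x))).
  { apply (is_lim_seq_abs _ (f x - fourier_sum f N x)).
    apply is_lim_seq_minus'; [now apply fourier_sum_lim|apply is_lim_seq_const]. }
  refine (is_lim_seq_le_loc _ _ _ (t N) _ Hlim (is_lim_seq_const _)).
  exists N; intros M HM; unfold fourier_sum.
  replace (mean f + psum (fun k => fourier_term f (S k) x) M -
    (mean f + psum (fun k => fourier_term f (S k) x) N)) with
    (psum (fun k => fourier_term f (S k) x) M - psum (fun k => fourier_term f (S k) x) N) by ring.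
  apply Rle_trans with (psum v M - psum v N).
  - apply psum_diff_abs; auto; intros k.
    apply Rle_trans with (1 := fourier_term_bound f k x); unfold v.
    assert (1 <= INR (S k)) by (rewrite S_INR; generalize (pos_INR k); lra).
    generalize (coef_size_pos f k); nra.
  - unfold t; generalize (HtW M); lra. }
set (phi := fun N y => strip_extension d f N x0 y).
(* Limits are taken in the order M, y, N. For larger M the minimum principle gives an increment of
   at least [-2 * t M]; passing from M back to N costs at most [K * t N * - y]. Letting M grow with
   [y] fixed removes the first error, and the second, being linear in [y], can be differentiated at
   the surface. *)
assert (Hphi : forall N y, - d <= y <= 0 -> K * t N * y <= phi N y - phi N 0).
{ intros N y Hy.
  assert (Hlim : is_lim_seq (fun M => -2 * t M + K * t N * y) (-2 * 0 + K * t N * y)).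
  { apply is_lim_seq_plus'; [|apply is_lim_seq_const].
    apply (is_lim_seq_scal_l t (-2) 0 Ht0). }
  enough (Rbar_le (-2 * 0 + K * t N * y) (phi N y - phi N 0)) as Hle by (simpl in Hle; lra).
  refine (is_lim_seq_le_loc _ _ _ _ _ Hlim (is_lim_seq_const _)).
  exists N; intros M HM.
  assert (HtM : 0 <= t M) by (generalize (HtW M); unfold t; lra).
  assert (Hlow : - t M <= phi M y).
  { apply strip_extension_lower_bound; auto.
    intros x; generalize (Hpos x) (proj1 (Rabs_le_between _ _) (Htail M x)); lra. }
  assert (Htop : phi M 0 <= t M).
  { unfold phi; rewrite strip_extension_top by exact Hd.
    generalize (proj1 (Rabs_le_between _ _) (Htail M x0)); lra. }
  set (p := fun k => (strip_profile d (S k) y - 1) * c k).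
  assert (Hdiff : forall L, phi L y - phi L 0 = mean f * (y / d) + psum p L).
  { intros L; unfold phi; rewrite strip_extension_top by exact Hd.
    unfold strip_extension, fourier_sum, p.
    replace (psum (fun k => (strip_profile d (S k) y - 1) * c k) L) with
      (psum (fun k => strip_profile d (S k) y * c k) L - psum c L).
    - unfold c; ring.
    - rewrite <- (Rmult_1_l (psum c L)); unfold Rminus; rewrite Ropp_mult_distr_l, <- psum_scal,
        <- psum_plus; apply psum_ext; intros k; ring. }
  assert (Hp : Rabs (psum p M - psum p N) <=
    psum (fun k => K * - y * v k) M - psum (fun k => K * - y * v k) N).
  { apply psum_diff_abs; [|exact HM]; intros k; unfold p.
    destruct (strip_profile_slope d k y Hd Hy) as [Hs0 Hs1]; fold K in Hs1.
    rewrite Rabs_mult, <- Rabs_Ropp, Ropp_minus_distr, (Rabs_pos_eq _ Hs0).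
    apply Rle_trans with (K * INR (S k) * - y * coef_size f k).
    - apply Rmult_le_compat; [exact Hs0|apply Rabs_pos|exact Hs1|exact (fourier_term_bound f k x0)].
    - unfold v; right; ring. }
  rewrite !psum_scal in Hp; apply Rabs_le_between in Hp.
  assert (Hfin : K * - y * psum v M - K * - y * psum v N <= K * - y * t N).
  { unfold t; rewrite <- Rmult_minus_distr_l; apply Rmult_le_compat_l; [nra|].
    generalize (HtW M); lra. }
  generalize (Hdiff M) (Hdiff N); lra. }
set (w := fun k => INR (S k) * coth (INR (S k) * d) * c k).
assert (Hder : forall N, is_derive (phi N) 0 (mean f / d + psum w N)).
{ intros N; unfold phi, strip_extension.
  apply (is_derive_plus (fun y => mean f * (1 + y / d))).
  - auto_derive; auto; field; lra.
  - induction N as [|N IH]; [apply (is_derive_const 0)|].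
    apply (is_derive_plus (fun y => psum (fun k => strip_profile d (S k) y * c k) N)).
    + exact IH.
    + unfold w, strip_profile, coth, sinh, cosh; fold (c N).
      assert (Hs : sinh (INR (S N) * d) <> 0).
      { apply Rgt_not_eq, sinh_pos, Rmult_lt_0_compat; [apply lt_0_INR; lia|exact Hd]. }
      unfold sinh in Hs; set (n := INR (S N)) in *.
      auto_derive; auto; rewrite Rplus_0_l; field.
      intros E; apply Hs; rewrite E; lra. }
assert (Hbound : forall N, mean f / d + psum w N <= K * t N).
{ intros N; apply (derive_at_right_end (phi N) _ _ d); auto. }
assert (Hw : is_lim_seq (psum w) (hilbert d (Derive f) x0)).
{ rewrite hilbert_derive by exact Hf; apply is_series_psum, Series_correct.
  now apply hilbert_derive_summable. }
enough (Rbar_le (mean f / d + hilbert d (Derive f) x0) (K * 0)) as H by (simpl in H; lra).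
refine (is_lim_seq_le _ _ _ _ Hbound _ _).
- apply is_lim_seq_plus'; [apply is_lim_seq_const|exact Hw].
- apply (is_lim_seq_scal_l t K 0 Ht0).
Qed.

(** * Cubic functions of the profile *)

(** [Series] is total, so linearity of [hilbert] must carry the convergence of its series along. *)
Definition hilbert_summable (d : R) (f : R -> R) (x : R) : Prop :=
  ex_series (fun k =>
    fourier_cos f (S k) * coth (INR (S k) * d) * sin (INR (S k) * x)
    - fourier_sin f (S k) * coth (INR (S k) * d) * cos (INR (S k) * x)).

Lemma fourier_cos_ext f g n : (forall t, f t = g t) -> fourier_cos f n = fourier_cos g n.
Proof.
intros H; unfold fourier_cos; f_equal; apply RInt_ext; intros t _; now rewrite H.
Qed.

Lemma fourier_sin_ext f g n : (forall t, f t = g t) -> fourier_sin f n = fourier_sin g n.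
Proof.
intros H; unfold fourier_sin; f_equal; apply RInt_ext; intros t _; now rewrite H.
Qed.

Lemma hilbert_ext d f g x : (forall t, f t = g t) -> hilbert d f x = hilbert d g x.
Proof.
intros H; apply Series_ext; intros k; cbv zeta.
now rewrite (fourier_cos_ext f g), (fourier_sin_ext f g).
Qed.

Lemma hilbert_summable_ext d f g x : (forall t, f t = g t) ->
  hilbert_summable d f x -> hilbert_summable d g x.
Proof.
intros H; apply ex_series_ext; intros k.
now rewrite (fourier_cos_ext f g), (fourier_sin_ext f g).
Qed.

Lemma hilbert_summable_derive d f x : 0 < d -> C2_periodic f ->
  hilbert_summable d (Derive f) x.
Proof.
intros Hd Hf; refine (ex_series_ext _ _ _ (hilbert_derive_summable d f x Hd Hf)); intros k.
destruct Hf as [Hp Hf' Hf'' _]; assert (Hc := derivable_cont _ Hf'').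
rewrite fourier_cos_derive, fourier_sin_derive; auto.
unfold fourier_term; match goal with |- ?u = ?v => change (@eq R u v) end; ring.
Qed.

Lemma fourier_cos_lin a b f g n : cont f -> cont g ->
  fourier_cos (fun t => a * f t + b * g t) n = a * fourier_cos f n + b * fourier_cos g n.
Proof.
intros Hf Hg.
change (/ PI * period_int (fun t => (a * f t + b * g t) * cos (INR n * t)) =
  a * (/ PI * period_int (fun t => f t * cos (INR n * t)))
  + b * (/ PI * period_int (fun t => g t * cos (INR n * t)))).
rewrite (period_int_ext _
  (fun t => a * (f t * cos (INR n * t)) + b * (g t * cos (INR n * t)))) by (intros; ring).
rewrite period_int_plus, !period_int_scal; auto with cont; ring.
Qed.

Lemma fourier_sin_lin a b f g n : cont f -> cont g ->
  fourier_sin (fun t => a * f t + b * g t) n = a * fourier_sin f n + b * fourier_sin g n.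
Proof.
intros Hf Hg.
change (/ PI * period_int (fun t => (a * f t + b * g t) * sin (INR n * t)) =
  a * (/ PI * period_int (fun t => f t * sin (INR n * t)))
  + b * (/ PI * period_int (fun t => g t * sin (INR n * t)))).
rewrite (period_int_ext _
  (fun t => a * (f t * sin (INR n * t)) + b * (g t * sin (INR n * t)))) by (intros; ring).
rewrite period_int_plus, !period_int_scal; auto with cont; ring.
Qed.

Lemma hilbert_lin d a b f g x : cont f -> cont g ->
  hilbert_summable d f x -> hilbert_summable d g x ->
  hilbert_summable d (fun t => a * f t + b * g t) x /\
  hilbert d (fun t => a * f t + b * g t) x = a * hilbert d f x + b * hilbert d g x.
Proof.
intros Hf Hg [lf Hlf] [lg Hlg].
assert (H : is_series (fun k =>
    fourier_cos (fun t => a * f t + b * g t) (S k) * coth (INR (S k) * d) * sin (INR (S k) * x)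
    - fourier_sin (fun t => a * f t + b * g t) (S k) * coth (INR (S k) * d)
      * cos (INR (S k) * x)) (a * lf + b * lg)).
{ refine (is_series_ext _ _ _ _
    (is_series_plus _ _ _ _ (is_series_scal_l a _ _ Hlf) (is_series_scal_l b _ _ Hlg))).
  intros k; rewrite fourier_cos_lin, fourier_sin_lin by assumption.
  match goal with |- plus (scal _ ?u) (scal _ ?v) = ?z => change (a * u + b * v = z) end; ring. }
split; [now exists (a * lf + b * lg)|].
unfold hilbert; cbv zeta.
now rewrite (is_series_unique _ _ H), (is_series_unique _ _ Hlf), (is_series_unique _ _ Hlg).
Qed.

Lemma C2_periodic_intro (f f1 f2 : R -> R) : periodic f ->
  (forall x, is_derive f x (f1 x)) -> (forall x, is_derive f1 x (f2 x)) -> cont f2 ->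
  C2_periodic f.
Proof.
intros Hp H1 H2 Hc.
assert (E1 : forall x, f1 x = Derive f x).
{ intros x; symmetry; apply is_derive_unique, H1. }
assert (H2' : forall x, is_derive (Derive f) x (f2 x)).
{ intros x; apply (is_derive_ext f1); auto. }
split; auto.
- intros x; now exists (f1 x).
- intros x; now exists (f2 x).
- intros x; apply (continuous_ext f2); [|apply Hc].
  intros t; symmetry; apply is_derive_unique, H2'.
Qed.

Definition cubic (c0 c1 c2 c3 : R) (f : R -> R) (t : R) : R :=
  c0 + c1 * f t + c2 * f t ^ 2 + c3 * f t ^ 3.

Lemma derive_cubic c0 c1 c2 c3 f x : ex_derive f x ->
  is_derive (cubic c0 c1 c2 c3 f) x ((c1 + 2 * c2 * f x + 3 * c3 * f x ^ 2) * Derive f x).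
Proof.
intros H; unfold cubic; auto_derive; [auto|].
change (Derive (fun x => f x) x) with (Derive f x); ring.
Qed.

Lemma C2_periodic_cubic c0 c1 c2 c3 f : C2_periodic f -> C2_periodic (cubic c0 c1 c2 c3 f).
Proof.
intros [Hp Hd Hd2 Hc].
assert (H0 := derivable_cont f Hd); assert (H1 := derivable_cont _ Hd2).
apply (C2_periodic_intro _ (fun x => (c1 + 2 * c2 * f x + 3 * c3 * f x ^ 2) * Derive f x)
  (fun x => (2 * c2 + 6 * c3 * f x) * Derive f x * Derive f x
            + (c1 + 2 * c2 * f x + 3 * c3 * f x ^ 2) * Derive (Derive f) x)).
- intros x; unfold cubic; now rewrite Hp.
- intros x; now apply derive_cubic.
- intros x; auto_derive; [auto|].
  change (Derive (fun x => f x) x) with (Derive f x).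
  change (Derive (fun t => Derive f t) x) with (Derive (Derive f) x); ring.
- auto 10 with cont.
Qed.

Lemma mean_cubic c0 c1 c2 c3 f : cont f ->
  mean (cubic c0 c1 c2 c3 f) =
  c0 + c1 * mean f + c2 * mean (fun t => f t ^ 2) + c3 * mean (fun t => f t ^ 3).
Proof.
intros Hf; assert (HPI := PI_RGT_0).
unfold mean; fold (period_int (cubic c0 c1 c2 c3 f)); fold (period_int f);
  fold (period_int (fun t => f t ^ 2)); fold (period_int (fun t => f t ^ 3)).
unfold cubic.
rewrite !period_int_plus, !period_int_scal, period_int_const; auto with cont.
field; lra.
Qed.

Lemma hilbert_quadratic d k1 k2 k3 f x : 0 < d -> C2_periodic f ->
  hilbert d (fun t => (k1 + k2 * f t + k3 * f t ^ 2) * Derive f t) x =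
  k1 * hilbert d (Derive f) x + k2 * hilbert d (fun t => f t * Derive f t) x
  + k3 * hilbert d (fun t => f t ^ 2 * Derive f t) x.
Proof.
intros Hd Hf.
assert (H0 := derivable_cont f (c2_derive _ Hf)).
assert (H1 := derivable_cont _ (c2_derive2 _ Hf)).
assert (Hs : forall c1 c2 c3 g,
  (forall t, (c1 + 2 * c2 * f t + 3 * c3 * f t ^ 2) * Derive f t = g t) ->
  hilbert_summable d g x).
{ intros c1 c2 c3 g Hg.
  refine (hilbert_summable_ext _ _ _ _ _
    (hilbert_summable_derive d _ x Hd (C2_periodic_cubic 0 c1 c2 c3 f Hf))).
  intros t; rewrite <- Hg; apply is_derive_unique, derive_cubic, Hf. }
(* Each piece is the derivative of a periodic polynomial in [f], namely [f], [f^2 / 2] and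
   [f^3 / 3], so the summability of derivatives applies. *)
assert (S1 : hilbert_summable d (Derive f) x) by (apply (Hs 1 0 0); intros; ring).
assert (S2 : hilbert_summable d (fun t => f t * Derive f t) x)
  by (apply (Hs 0 (/ 2) 0); intros; field).
assert (S3 : hilbert_summable d (fun t => f t ^ 2 * Derive f t) x)
  by (apply (Hs 0 0 (/ 3)); intros; field).
destruct (hilbert_lin d k1 k2 (Derive f) (fun t => f t * Derive f t) x) as [S12 E12];
  auto with cont.
destruct (hilbert_lin d 1 k3 (fun t => k1 * Derive f t + k2 * (f t * Derive f t))
  (fun t => f t ^ 2 * Derive f t) x) as [_ E]; auto with cont.
rewrite (hilbert_ext d _ (fun t => 1 * (k1 * Derive f t + k2 * (f t * Derive f t))
  + k3 * (f t ^ 2 * Derive f t))) by (intros; ring).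
rewrite E, E12; ring.
Qed.

(** Each cubic touching zero from above at [x0] yields one inequality that is linear in the three
    nonlocal quantities and in the moments of [f], ready for linear combination. *)
Lemma hilbert_cubic_at_zero d c0 c1 c2 c3 f x0 : 0 < d -> C2_periodic f ->
  (forall t, 0 <= cubic c0 c1 c2 c3 f t) -> cubic c0 c1 c2 c3 f x0 = 0 ->
  c1 * hilbert d (Derive f) x0 + 2 * c2 * hilbert d (fun t => f t * Derive f t) x0
  + 3 * c3 * hilbert d (fun t => f t ^ 2 * Derive f t) x0
  <= - ((c0 + c1 * mean f + c2 * mean (fun t => f t ^ 2) + c3 * mean (fun t => f t ^ 3)) / d).
Proof.
intros Hd Hf Hpos Hzero.
rewrite <- hilbert_quadratic, <- mean_cubic by (auto; apply derivable_cont, Hf).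
rewrite <- (hilbert_ext d (Derive (cubic c0 c1 c2 c3 f))).
- now apply hilbert_derive_at_zero; [|apply C2_periodic_cubic| |].
- intros t; apply is_derive_unique, derive_cubic, Hf.
Qed.

(** * Regularity of the profile *)

Lemma holder_continuous alpha C (f : R -> R) : 0 < alpha ->
  (forall x y, x <> y -> Rabs (f x - f y) / Rpower (Rabs (x - y)) alpha <= C) -> cont f.
Proof.
intros Ha H x; apply continuity_pt_filterlim, continuity_pt_locally; intros eps.
set (C' := Rabs C + 1).
assert (HC' : 0 < C') by (unfold C'; generalize (Rabs_pos C); lra).
assert (He : 0 < eps / C') by (apply Rdiv_lt_0_compat; [apply eps|exact HC']).
exists (mkposreal (Rpower (eps / C') (/ alpha)) (exp_pos _)); intros y Hy.
change (Rabs (y - x) < Rpower (eps / C') (/ alpha)) in Hy.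
destruct (Req_dec y x) as [->|Hyx]; [rewrite Rminus_diag, Rabs_R0; apply eps|].
assert (Hpos : 0 < Rabs (y - x)) by (apply Rabs_pos_lt; lra).
assert (Hlt : Rpower (Rabs (y - x)) alpha < eps / C').
{ replace (eps / C') with (Rpower (Rpower (eps / C') (/ alpha)) alpha).
  - apply Rlt_Rpower_l; auto.
  - rewrite Rpower_mult, Rinv_l, Rpower_1; lra. }
specialize (H y x Hyx).
set (p := Rpower (Rabs (y - x)) alpha) in *.
assert (Hp : 0 < p) by apply exp_pos.
assert (HC : C <= C') by (unfold C'; generalize (Rle_abs C); lra).
assert (Rabs (f y - f x) <= C' * p).
{ replace (Rabs (f y - f x)) with (Rabs (f y - f x) / p * p) by (field; lra).
  apply Rmult_le_compat_r; lra. }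
assert (C' * p < C' * (eps / C')) by now apply Rmult_lt_compat_l.
replace (C' * (eps / C')) with (pos eps) in * by (field; lra). lra.
Qed.

(** Nonnegativity rules out the conventional value 0 for the sum of opposite infinities, which would
    hide an infinite summand. *)
Lemma Rbar_plus_nonneg_lt (a b : Rbar) : Rbar_le 0 a -> Rbar_le 0 b ->
  Rbar_lt (Rbar_plus a b) p_infty -> Rbar_lt b p_infty.
Proof. destruct a, b; simpl; tauto. Qed.

Lemma Rbar_plus_nonneg (a b : Rbar) : Rbar_le 0 a -> Rbar_le 0 b -> Rbar_le 0 (Rbar_plus a b).
Proof. destruct a, b; simpl; try tauto; lra. Qed.

Lemma Lub_Rbar_nonneg (E : R -> Prop) r : 0 <= r -> E r -> Rbar_le 0 (Lub_Rbar E).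
Proof.
intros Hr HE; apply Rbar_le_trans with (Finite r); [exact Hr|].
now apply (proj1 (Lub_Rbar_correct E)).
Qed.

Lemma sup_norm_nonneg f : Rbar_le 0 (sup_norm f).
Proof. apply (Lub_Rbar_nonneg _ (Rabs (f 0))); [apply Rabs_pos|now exists 0]. Qed.

Lemma holder_seminorm_nonneg alpha f : Rbar_le 0 (holder_seminorm alpha f).
Proof.
apply (Lub_Rbar_nonneg _ (Rabs (f 0 - f 1) / Rpower (Rabs (0 - 1)) alpha)).
- apply Rmult_le_pos; [apply Rabs_pos|left; apply Rinv_0_lt_compat, exp_pos].
- exists 0, 1; split; [lra|reflexivity].
Qed.

Lemma C2alpha_C2_periodic alpha f : 0 < alpha -> periodic f -> C2alpha alpha f -> C2_periodic f.
Proof.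
intros Ha Hp [Hd Hn].
unfold C2alpha_norm in Hn.
assert (S0 := sup_norm_nonneg f); assert (S1 := sup_norm_nonneg (Derive f)).
assert (S2 := sup_norm_nonneg (Derive_n f 2)).
assert (S3 := holder_seminorm_nonneg alpha (Derive_n f 2)).
do 3 (apply Rbar_plus_nonneg_lt in Hn; [|assumption|repeat apply Rbar_plus_nonneg; assumption]).
split; auto.
- intros x; apply (proj1 (Hd x)).
- intros x; apply (proj2 (Hd x)).
- change (cont (Derive_n f 2)).
  unfold holder_seminorm in Hn.
  destruct (Lub_Rbar_correct (fun r => exists x y, x <> y /\
    r = Rabs (Derive_n f 2 x - Derive_n f 2 y) / Rpower (Rabs (x - y)) alpha)) as [Hub _].
  fold (holder_seminorm alpha (Derive_n f 2)) in Hn, Hub.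
  destruct (holder_seminorm alpha (Derive_n f 2)) as [C| |]; simpl in Hn, S3; try tauto.
  apply (holder_continuous alpha C); auto.
  intros x y Hxy; apply (Hub _); now exists x, y.
Qed.

Lemma even_periodic_range (f : R -> R) (a b : R) : periodic f -> (forall x, f (- x) = f x) ->
  (forall x, 0 <= x <= PI -> a <= f x <= b) -> forall x, a <= f x <= b.
Proof.
intros Hp He H x; destruct (period_reduce (- PI) x) as [z Hz].
rewrite <- (periodic_IZR f x z Hp); set (y := x + _) in *.
destruct (Rle_lt_dec 0 y).
- apply H; lra.
- rewrite <- He; apply H; lra.
Qed.

Lemma mean_ge f a : cont f -> (forall x, a <= f x) -> a <= mean f.
Proof.
intros Hf H; assert (HPI := PI_RGT_0).
assert (Hle := period_int_le _ _ (cont_const a) Hf H).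
rewrite period_int_const in Hle.
unfold mean; fold (period_int f).
replace a with (/ (2 * PI) * (2 * PI * a)) by (field; lra).
apply Rmult_le_compat_l; [left; apply Rinv_0_lt_compat; lra|exact Hle].
Qed.

(** * The amplitude inequality *)

(* Writing [hilbert d (Derive f) x = (f x - mean f) / d + integral of k (f x - f)]
   with a positive kernel [k], the difference of the surface equation at crest
   and trough is an integral of cubic polynomials in [eta].  The sign condition
   on [psi_y], weighted equally at crest and trough, makes both of them
   nonnegative. *)
Lemma crest_trough_inequality g gamma d w : 0 < g -> 0 < d -> gamma <= 0 ->
  C2_periodic (eta w) -> mean (eta w) = d -> surface_equation g gamma d w ->
  (forall x, psi_y gamma d w x <= 0) -> 0 < head w - 2 * g * eta w 0 ->
  (forall x, eta w PI <= eta w x <= eta w 0) -> 0 < amplitude w ->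
  gamma ^ 2 * amplitude w ^ 2 / 6 + g * amplitude w < 2 * g * eta w PI.
Proof.
intros Hg Hd Hgam Hf Hmean Hsurf Hpsi Hstag Hrange HA.
unfold amplitude in *.
assert (S0 := Hsurf 0); assert (S1 := Hsurf PI).
assert (P0 := Hpsi 0); assert (P1 := Hpsi PI).
unfold coefficient in S0, S1; unfold psi_y in P0, P1.
rewrite (hilbert_ext d _ (fun t => (head w + (- 2 * g) * eta w t + (- gamma ^ 2) * eta w t ^ 2)
  * Derive (eta w) t)) in S0, S1 by (intros; ring).
rewrite hilbert_quadratic in S0, S1 by assumption.
set (a := eta w 0) in *; set (b := eta w PI) in *.
set (c := gamma ^ 2) in *.
assert (Hc : 0 <= c) by (unfold c; apply pow2_ge_0).
set (A := a - b) in *.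
assert (Z0 := hilbert_cubic_at_zero d a (-1) 0 0 (eta w) 0 Hd Hf).
assert (Z1 := hilbert_cubic_at_zero d (- b) 1 0 0 (eta w) PI Hd Hf).
(* Coefficients read off from the difference of the surface equations: after [LP] is added and
   [2 * L] split off, the crest terms are minus the left side of [Z2] and the trough terms minus
   that of [Z3]. The summand 4 g A in [Z3] pays for using [Q - 2 * g * a] at the trough as well. In
   [Q2] and [Q3] the cubics are rewritten in the distance to crest or trough, which lies in [0, A];
   there the factors A/2 - z/3 are nonnegative. *)
assert (Z2 := hilbert_cubic_at_zero d
  ((g + c * A / 2) * a ^ 2 - c * a ^ 3 / 3) (- 2 * a * (g + c * A / 2) + c * a ^ 2)
  (g + c * A / 2 - c * a) (c / 3) (eta w) 0 Hd Hf).
assert (Z3 := hilbert_cubic_at_zero d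
  (- 4 * g * A * b + (c * A / 2 - g) * b ^ 2 + c * b ^ 3 / 3)
  (4 * g * A - 2 * b * (c * A / 2 - g) - c * b ^ 2)
  (c * A / 2 - g + c * b) (- (c / 3)) (eta w) PI Hd Hf).
rewrite Hmean in Z0, Z1, Z2, Z3.
set (A1 := hilbert d (Derive (eta w)) 0) in *.
set (B1 := hilbert d (Derive (eta w)) PI) in *.
set (A2 := hilbert d (fun t => eta w t * Derive (eta w) t) 0) in *.
set (B2 := hilbert d (fun t => eta w t * Derive (eta w) t) PI) in *.
set (A3 := hilbert d (fun t => eta w t ^ 2 * Derive (eta w) t) 0) in *.
set (B3 := hilbert d (fun t => eta w t ^ 2 * Derive (eta w) t) PI) in *.
set (M2 := mean (fun t => eta w t ^ 2)) in *.
set (M3 := mean (fun t => eta w t ^ 3)) in *.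
set (N := mean (fun t => eta w t * hilbert d (Derive (eta w)) t)) in *.
specialize (Z0 ltac:(intros t; unfold cubic; generalize (Hrange t); lra)
  ltac:(unfold cubic; fold a; ring)).
specialize (Z1 ltac:(intros t; unfold cubic; generalize (Hrange t); lra)
  ltac:(unfold cubic; fold b; ring)).
assert (Q2 : forall t, 0 <= cubic ((g + c * A / 2) * a ^ 2 - c * a ^ 3 / 3)
  (- 2 * a * (g + c * A / 2) + c * a ^ 2) (g + c * A / 2 - c * a) (c / 3) (eta w) t).
{ intros t; specialize (Hrange t); unfold cubic.
  set (u := a - eta w t); replace (eta w t) with (a - u) by (unfold u; ring).
  assert (Hu : 0 <= u <= A) by (unfold u, A; lra).
  match goal with |- 0 <= ?e =>
    replace e with (u ^ 2 * (g + c * (A / 2 - u / 3))) by field end.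
  apply Rmult_le_pos; [apply pow2_ge_0|].
  assert (0 <= c * (A / 2 - u / 3)) by (apply Rmult_le_pos; lra). lra. }
assert (Q3 : forall t, 0 <= cubic (- 4 * g * A * b + (c * A / 2 - g) * b ^ 2 + c * b ^ 3 / 3)
  (4 * g * A - 2 * b * (c * A / 2 - g) - c * b ^ 2)
  (c * A / 2 - g + c * b) (- (c / 3)) (eta w) t).
{ intros t; specialize (Hrange t); unfold cubic.
  set (v := eta w t - b); replace (eta w t) with (b + v) by (unfold v; ring).
  assert (Hv : 0 <= v <= A) by (unfold v, A; lra).
  match goal with |- 0 <= ?e =>
    replace e with (v * (g * (4 * A - v) + c * (v * (A / 2 - v / 3)))) by field end.
  apply Rmult_le_pos; [lra|].
  assert (0 <= g * (4 * A - v)) by (apply Rmult_le_pos; lra).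
  assert (0 <= c * (v * (A / 2 - v / 3)))
    by (apply Rmult_le_pos; [exact Hc|apply Rmult_le_pos; lra]).
  lra. }
specialize (Z2 Q2 ltac:(unfold cubic; fold a; field)); clear Q2.
specialize (Z3 Q3 ltac:(unfold cubic; fold b; field)); clear Q3.
set (Q := head w) in *; set (m := flux w) in *.
set (i := / d).
assert (Hi : 0 < i) by now apply Rinv_0_lt_compat.
assert (D : forall c0 c1 c2 c3, - ((c0 + c1 * d + c2 * M2 + c3 * M3) / d) =
  - (c0 * i + c1 + c2 * M2 * i + c3 * M3 * i)) by (intros; unfold i; field; lra).
rewrite D in Z0, Z1, Z2, Z3; clear D.
(* [Z0] and [Z1] give A1 - B1 >= A/d. This is the source of strictness in the result. *)
assert (L : 0 < (Q - 2 * g * a) * (A1 - B1)).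
{ apply Rmult_lt_0_compat; [exact Hstag|].
  assert (0 < i * A) by now apply Rmult_lt_0_compat. unfold A in *; lra. }
(* [gamma A psi_y >= 0], summed over crest and trough. *)
assert (LP : 0 <= gamma * A * ((m / d + gamma / (2 * d) * M2 + gamma * A2 - gamma * a * A1 - gamma * a)
  + (m / d + gamma / (2 * d) * M2 + gamma * B2 - gamma * b * B1 - gamma * b))).
{ match goal with |- 0 <= _ * ?e => replace (gamma * A * e) with (- gamma * A * - e) by ring end.
  repeat apply Rmult_le_pos; lra. }
(* A linear combination over monomials: [S0] minus [S1], with [LP], [Z2], [Z3] and twice [L]. With u
   = a - eta and v = eta - b, so that u + v = A, the two cubics add up to g A^2 + 2 g A v + c A^3/6,
   hence [M2] and [M3] cancel. *)
assert (Hfin : i * A * (c * A ^ 2 / 6 + g * A - 2 * g * b) < 0).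
{ unfold Rdiv in *; rewrite ?Rinv_mult in *; fold i in S0, S1, LP, Z2, Z3.
  clear - S0 S1 LP Z0 Z1 Z2 Z3 L.
  unfold c, A in *. clear c A.
  lra. }
assert (0 < i * A) by now apply Rmult_lt_0_compat.
apply Rnot_le_lt; intros Hcon.
assert (0 <= i * A * (c * A ^ 2 / 6 + g * A - 2 * g * b)) by (apply Rmult_le_pos; lra).
lra.
Qed.

Lemma curve_amplitude g gamma d w : 0 < g -> 0 < d -> gamma <= 0 ->
  on_bifurcation_curve g gamma d w ->
  0 <= amplitude w < 2 * d /\ gamma ^ 2 * amplitude w ^ 2 < 12 * g * d.
Proof.
intros Hg Hd Hgam (C & send & s & HC & Hs & Hsend & ->).
assert (HPI := PI_RGT_0).
assert (Hgd : 0 < g * d) by now apply Rmult_lt_0_compat.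
assert (Hsol := bc_solution _ _ _ _ _ HC s Hs).
assert (Hwave := bc_wave _ _ _ _ _ HC s Hs Hsend).
destruct (bc_curve _ _ _ _ _ HC) as (alpha & Halpha & Hreg & _).
set (w := C s) in *.
assert (Hper : periodic (eta w)).
{ intros x; apply (cp_periodic _ _ (cs_param _ _ _ _ Hsol)); unfold closed_strip; lra. }
assert (HC2 : C2_periodic (eta w)).
{ apply (C2alpha_C2_periodic alpha); [lra|exact Hper|now apply Hreg]. }
destruct (classic (laminar d w)) as [Hlam|Hlam].
{ unfold amplitude; rewrite !Hlam, Rminus_diag, pow_ne_zero, Rmult_0_r by discriminate; lra. }
destruct (cw_monotone _ _ _ _ Hwave Hlam) as [Hdec _].
assert (Hmono : forall x y, 0 <= x -> x < y -> y <= PI -> eta w y < eta w x).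
{ intros x y Hx Hxy Hy.
  destruct (MVT_cor2 (eta w) (Derive (eta w)) x y Hxy) as [c [Hc Hc']].
  { intros; apply is_derive_Reals, Derive_correct, (c2_derive _ HC2). }
  generalize (Hdec c ltac:(lra)); nra. }
assert (Hrange : forall x, eta w PI <= eta w x <= eta w 0).
{ apply even_periodic_range; [exact Hper|apply (cs_even _ _ _ _ Hsol)|].
  intros x [Hx0 HxPI]; split.
  - destruct HxPI as [H| ->]; [|lra]; left; apply Hmono; lra.
  - destruct Hx0 as [H| <-]; [|lra]; left; apply Hmono; lra. }
assert (HA : 0 < amplitude w).
{ unfold amplitude; generalize (Hmono 0 PI); lra. }
assert (Htrough : eta w PI <= d).
{ rewrite <- (cs_mean _ _ _ _ Hsol); apply mean_ge; [|apply Hrange].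
  apply derivable_cont, (c2_derive _ HC2). }
assert (Hmain : gamma ^ 2 * amplitude w ^ 2 / 6 + g * amplitude w < 2 * g * eta w PI).
{ apply (crest_trough_inequality g gamma d); auto.
  - apply (cs_mean _ _ _ _ Hsol).
  - apply (cs_surface _ _ _ _ Hsol).
  - now apply (cw_favorable _ _ _ _ Hwave).
  - apply (cw_no_stagnation _ _ _ _ Hwave). }
assert (Hgt : g * eta w PI <= g * d) by (apply Rmult_le_compat_l; lra).
assert (H0 : 0 <= gamma ^ 2 * amplitude w ^ 2) by (apply Rmult_le_pos; apply pow2_ge_0).
assert (HgA : 0 < g * amplitude w) by now apply Rmult_lt_0_compat.
(* Each bound drops one of the two nonnegative terms on the left of [Hmain]. *)
repeat split; [lra| |lra].
apply Rmult_lt_reg_l with (1 := Hg); lra.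
Qed.

Lemma amplitude_vorticity_bound g gamma d a : gamma < 0 -> 0 <= a ->
  gamma ^ 2 * a ^ 2 < 12 * g * d -> a < / Rabs gamma * sqrt (12 * g * d).
Proof.
intros Hgam Ha H.
assert (Habs : 0 < Rabs gamma) by (apply Rabs_pos_lt; lra).
apply Rmult_lt_reg_l with (1 := Habs).
rewrite <- Rmult_assoc, Rinv_r, Rmult_1_l by lra.
rewrite <- (sqrt_pow2 (Rabs gamma * a)) by (apply Rmult_le_pos; lra).
rewrite Rpow_mult_distr, pow2_abs.
apply sqrt_lt_1_alt; split; [|exact H].
apply Rmult_le_pos; apply pow2_ge_0.
Qed.

Theorem theorem1p2 : forall g d : R, 0 < g -> 0 < d ->
  (forall gamma : R, gamma <= 0 ->
     forall w : wave, on_bifurcation_curve g gamma d w ->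
       Rbar_lt (Finite (amplitude w))
               (Rbar_min (Finite (2 * d)) (vorticity_bound g d gamma)))
  /\
  (exists B : R, forall gamma : R, gamma <= 0 ->
     forall w : wave, on_bifurcation_curve g gamma d w ->
       Rabs (amplitude w) <= B)
  /\
  (forall eps : R, 0 < eps ->
     exists Gamma : R, forall gamma : R, gamma <= 0 -> gamma < Gamma ->
     forall w : wave, on_bifurcation_curve g gamma d w ->
       Rabs (amplitude w) < eps).
Proof.
intros g d Hg Hd; split; [|split].
- intros gamma Hgam w Hw.
  destruct (curve_amplitude g gamma d w Hg Hd Hgam Hw) as [HA Hv].
  unfold vorticity_bound; destruct (Req_EM_T gamma 0) as [->|Hn].
  + apply HA.
  + simpl; apply Rmin_glb_lt; [apply HA|].
    apply amplitude_vorticity_bound; [lra|apply HA|exact Hv].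
- exists (2 * d); intros gamma Hgam w Hw.
  destruct (curve_amplitude g gamma d w Hg Hd Hgam Hw) as [HA _].
  rewrite Rabs_pos_eq; lra.
(* The threshold at which the vorticity bound equals [eps]. *)
- intros eps Heps; exists (- (sqrt (12 * g * d) / eps)); intros gamma Hgam Hlt w Hw.
  destruct (curve_amplitude g gamma d w Hg Hd Hgam Hw) as [HA Hv].
  rewrite Rabs_pos_eq by lra.
  assert (Hq : 0 <= sqrt (12 * g * d) / eps).
  { apply Rmult_le_pos; [apply sqrt_pos|left; now apply Rinv_0_lt_compat]. }
  apply Rlt_le_trans with (/ Rabs gamma * sqrt (12 * g * d)).
  { apply amplitude_vorticity_bound; [lra|apply HA|exact Hv]. }
  rewrite Rabs_left by lra.
  apply Rmult_le_reg_l with (- gamma); [lra|].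
  rewrite <- Rmult_assoc, Rinv_r, Rmult_1_l by lra.
  replace (sqrt (12 * g * d)) with (sqrt (12 * g * d) / eps * eps) by (field; lra).
  apply Rmult_le_compat_r; lra.
Qed.
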